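(* There is an online algorithm (Algorithm 3) for submodular maximization subject to linear packing constraints which, without knowledge of $B$ or $d$, is $\Omega\!\left(\alpha d^{-\frac{2}{B-1}}\right)$-competitive whenever $B\ge2$: there is an absolute constant $c_0>0$ such that its integral output $y\in\{0,1\}^U$ satisfies $Ay\le b$ and $\mathbb{E}[F(y)]\ge (c_0\alpha d^{-\frac{2}{B-1}}-o(1))\,F^*$.
   Context: Linear packing setting. $U$ is a set of $n$ items; $A=(a_{i,j})\in\mathbb{R}_{\ge0}^{m\times U}$ and $b\in\mathbb{R}_{>0}^m$; w.l.o.g. $\max_j a_{i,j}\le1$ for each $i$. The capacity ratio is $B=\min_{i\in[m]} b_i/\max_{j} a_{i,j}$, and the column sparsity $d$ is the maximum number of nonzero entries in a column of $A$. $f\colon 2^U\to\mathbb{R}_{\ge0}$ is monotone submodular with multilinear extension $F(x)=\sum_{R\subseteq U}f(R)\prod_{i\in R}x_i\prod_{i\in U\setminus R}(1-x_i)$, $x\in[0,1]^U$, and $F^*=\sup\{F(x):x\in[0,1]^U,Ax\le b\}$. Items arrive one per round in uniformly random order; the column of item $j$ is revealed on arrival and the algorithm must immediately and irrevocably set $y_j\in\{0,1\}$, keeping $Ay\le b$. $f$ is known on subsets of arrived items. For $S\subseteq U$, $\mathcal{P}(\frac{\ell}{n},S)=\{x\in[0,1]^U: Ax\le\frac{\ell}{n}b,\ x_i=0\ \forall i\notin S\}$; the algorithm has access to an oracle $\mathcal{A}_F$ returning, for each such polytope $P$, a point $\mathcal{A}_F(P)\in P$ with $F(\mathcal{A}_F(P))\ge\alpha\sup_{x\in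 P}F(x)$, $\alpha\in(0,1]$. Algorithm 3: start with $x=0$, $S=\emptyset$; in round $\ell$, when item $j$ arrives, set $S:=S\cup\{j\}$, compute $\tilde x^{(\ell)}=\mathcal{A}_F(\mathcal{P}(\frac{\ell}{n},S))$, let $\hat x^{(\ell)}$ be $e_j$ with probability $\tilde x^{(\ell)}_j$ and $0$ otherwise; if $A(x+\hat x^{(\ell)})\le b$ set $x:=x+\hat x^{(\ell)}$; output $y=x$. *)

(* Defs.v *)
From Stdlib Require Import Reals Lra List Arith.
Import ListNotations.
Open Scope R_scope.

Fixpoint sumR (l : list R) : R := match l with nil => 0 | x :: t => x + sumR t end.
Fixpoint prodR (l : list R) : R := match l with nil => 1 | x :: t => x * prodR t end.
Definition sum_lt (n : nat) (g : nat -> R) : R := sumR (map g (seq 0 n)).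

(* all bool lists of length n = all subsets of U = {0,..,n-1} *)
Fixpoint allbools (n : nat) : list (list bool) :=
  match n with
  | O => [nil]
  | S k => map (cons true) (allbools k) ++ map (cons false) (allbools k)
  end.

Fixpoint insert_all (a : nat) (l : list nat) : list (list nat) :=
  match l with
  | nil => [[a]]
  | h :: t => (a :: h :: t) :: map (cons h) (insert_all a t)
  end.
Fixpoint perms (l : list nat) : list (list nat) :=
  match l with
  | nil => [nil]
  | h :: t => flat_map (insert_all h) (perms t)
  end.

(* ---------- set functions on U = {0,..,n-1}, subsets as bool lists of length n ---------- *)
Definition memb (S : list bool) (i : nat) : bool := nth i S false.
Definition setU (n : nat) (S T : list bool) : list bool :=
  map (fun i => orb (memb S i) (memb T i)) (seq 0 n).
Definition setI (n : nat) (S T : list bool) : list bool :=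
  map (fun i => andb (memb S i) (memb T i)) (seq 0 n).
Definition subsetb (n : nat) (S T : list bool) : Prop :=
  forall i, (i < n)%nat -> memb S i = true -> memb T i = true.

Definition nonneg_setfun (n : nat) (f : list bool -> R) : Prop :=
  forall S, length S = n -> 0 <= f S.
Definition monotone_setfun (n : nat) (f : list bool -> R) : Prop :=
  forall S T, length S = n -> length T = n -> subsetb n S T -> f S <= f T.
Definition submodular_setfun (n : nat) (f : list bool -> R) : Prop :=
  forall S T, length S = n -> length T = n ->
    f (setU n S T) + f (setI n S T) <= f S + f T.

Definition multilin (n : nat) (f : list bool -> R) (x : nat -> R) : R :=
  sumR (map (fun Rs => f Rs *
          prodR (map (fun i => if memb Rs i then x i else 1 - x i) (seq 0 n)))
        (allbools n)).

Definition rowdot (n : nat) (A : nat -> nat -> R) (i : nat) (x : nat -> R) : R :=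
  sum_lt n (fun j => A i j * x j).

Definition feasible_frac (n m : nat) (A : nat -> nat -> R) (b : nat -> R) (x : nat -> R) : Prop :=
  (forall j, (j < n)%nat -> 0 <= x j <= 1) /\
  (forall i, (i < m)%nat -> rowdot n A i x <= b i).

Definition is_Fstar (n m : nat) (A : nat -> nat -> R) (b : nat -> R) (f : list bool -> R) (Fs : R) : Prop :=
  is_lub (fun v => exists x, feasible_frac n m A b x /\ v = multilin n f x) Fs.

Definition inP (n m : nat) (A : nat -> nat -> R) (b : nat -> R) (l : nat) (Sarr : nat -> bool)
  (x : nat -> R) : Prop :=
  (forall j, (j < n)%nat -> 0 <= x j <= 1) /\
  (forall i, (i < m)%nat -> rowdot n A i x <= (INR l / INR n) * b i) /\
  (forall j, (j < n)%nat -> Sarr j = false -> x j = 0).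

Definition oracle_ok (n m : nat) (A : nat -> nat -> R) (b : nat -> R) (f : list bool -> R)
  (alpha : R) (O : nat -> (nat -> bool) -> nat -> R) : Prop :=
  forall l Sarr,
    inP n m A b l Sarr (O l Sarr) /\
    (forall x, inP n m A b l Sarr x -> alpha * multilin n f x <= multilin n f (O l Sarr)).

Definition rowmax (n : nat) (A : nat -> nat -> R) (i : nat) : R :=
  fold_right Rmax 0 (map (A i) (seq 0 n)).
Definition capB (n m : nat) (A : nat -> nat -> R) (b : nat -> R) : R :=
  match seq 0 m with
  | nil => 0
  | i0 :: is => fold_right (fun i acc => Rmin (b i / rowmax n A i) acc)
                           (b i0 / rowmax n A i0) is
  end.

Definition colsp (n m : nat) (A : nat -> nat -> R) : nat :=
  fold_right Nat.max 0%nat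
    (map (fun j => length (filter (fun i => if Req_EM_T (A i j) 0 then false else true)
                                  (seq 0 m)))
         (seq 0 n)).

Definition indicator (y : nat -> bool) : nat -> R := fun j => if y j then 1 else 0.
Definition int_feasible (n m : nat) (A : nat -> nat -> R) (b : nat -> R) (y : nat -> bool) : Prop :=
  forall i, (i < m)%nat -> rowdot n A i (indicator y) <= b i.
Definition int_feasibleb (n m : nat) (A : nat -> nat -> R) (b : nat -> R) (y : nat -> bool) : bool :=
  forallb (fun i => if Rle_dec (rowdot n A i (indicator y)) (b i) then true else false)
          (seq 0 m).

(* One round l (1-based) with arrival order sigma and coin outcome c
   (c = true: the coin "x^hat = e_j", which has probability x~_j).
   The state is (current integral x, probability of the coin outcomes so far). *)
Definition step (n m : nat) (A : nat -> nat -> R) (b : nat -> R)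
  (O : nat -> (nat -> bool) -> nat -> R) (sigma : list nat) (l : nat) (c : bool)
  (st : (nat -> bool) * R) : (nat -> bool) * R :=
  let (y, pr) := st in
  let j := nth (l - 1)%nat sigma 0%nat in
  let Sarr := fun i => existsb (Nat.eqb i) (firstn l sigma) in
  let p := O l Sarr j in
  if c then
    let y' := fun i => orb (y i) (Nat.eqb i j) in
    (if int_feasibleb n m A b y' then y' else y, pr * p)
  else (y, pr * (1 - p)).

Fixpoint go (n m : nat) (A : nat -> nat -> R) (b : nat -> R)
  (O : nat -> (nat -> bool) -> nat -> R) (sigma : list nat) (l : nat) (cs : list bool)
  (st : (nat -> bool) * R) : (nat -> bool) * R :=
  match cs with
  | nil => st
  | c :: cs' => go n m A b O sigma (S l) cs' (step n m A b O sigma l c st)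
  end.

Definition run (n m : nat) (A : nat -> nat -> R) (b : nat -> R)
  (O : nat -> (nat -> bool) -> nat -> R) (sigma : list nat) (cs : list bool)
  : (nat -> bool) * R :=
  go n m A b O sigma 1%nat cs (fun _ => false, 1).

(* E[F(y)] = E[f(y)] over a uniformly random arrival order and the internal coins *)
Definition expected_value (n m : nat) (A : nat -> nat -> R) (b : nat -> R)
  (f : list bool -> R) (O : nat -> (nat -> bool) -> nat -> R) : R :=
  / INR (Factorial.fact n) *
  sumR (map (fun sigma =>
         sumR (map (fun cs => snd (run n m A b O sigma cs) *
                               f (map (fst (run n m A b O sigma cs)) (seq 0 n)))
                   (allbools n)))
       (perms (seq 0 n))).

(* Main.v *)
Require Import Defs.
From Stdlib Require Import Reals List.
From Stdlib Require Import Lra Lia Arith Permutation FunctionalExtensionality.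
Import ListNotations.
Open Scope R_scope.

(* Generate the random order backwards: given the set S_k of the first k arrivals, the k-th
   item j is uniform in S_k, hence independent of all later picks W.  If x~ is the oracle's
   point, the expected gain of tentatively adding the k-th item to W is therefore at least
   (F(x~) - f(W)) / k, by submodularity.  Given S_k, round k consumes at most b_i / n of each
   capacity in expectation, so by a Chernoff bound and a union bound over the at most d rows of
   the arriving item, an item arriving in the first p n rounds is blocked with conditional
   probability at most 1/2, where p is of order d^(-1/(B-1)).  Since the conditioning is on the
   later rounds, half of every marginal gain over W survives, and the gains telescope to
   E f(accepted) >= E f(tentative) / 2.  Finally (k/n) x restricted to S_k is feasible for the
   oracle and has expected value at least (k/n)^2 F(x), and summing the gains of the rounds
   between p n / 2 and p n gives order alpha p^2 F(x). *)

(** * Finite sums *)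

Definition sumf {X} (g : X -> R) (l : list X) : R := sumR (map g l).

Lemma sumf_cons {X} (g : X -> R) a l : sumf g (a :: l) = g a + sumf g l.
Proof. reflexivity. Qed.

Lemma sumf_app {X} (g : X -> R) l1 l2 : sumf g (l1 ++ l2) = sumf g l1 + sumf g l2.
Proof.
  induction l1 as [|a l1 IH]; simpl; [unfold sumf; simpl; lra|].
  rewrite !sumf_cons, IH; lra.
Qed.

Lemma sumf_map {X Y} (h : X -> Y) (g : Y -> R) l : sumf g (map h l) = sumf (fun x => g (h x)) l.
Proof. unfold sumf; now rewrite map_map. Qed.

Lemma sumf_flat_map {X Y} (h : X -> list Y) (g : Y -> R) l :
  sumf g (flat_map h l) = sumf (fun x => sumf g (h x)) l.
Proof.
  induction l as [|a l IH]; [reflexivity|].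
  simpl; rewrite sumf_app, IH; reflexivity.
Qed.

Lemma sumf_perm {X} (g : X -> R) l1 l2 : Permutation l1 l2 -> sumf g l1 = sumf g l2.
Proof. induction 1; unfold sumf in *; simpl; lra. Qed.

Lemma sumf_le {X} (g h : X -> R) l :
  (forall a, In a l -> g a <= h a) -> sumf g l <= sumf h l.
Proof.
  induction l as [|a l IH]; intros H; [unfold sumf; simpl; lra|].
  rewrite !sumf_cons.
  pose proof (H a (or_introl eq_refl)).
  pose proof (IH (fun b Hb => H b (or_intror Hb))). lra.
Qed.

Lemma sumf_ext {X} (g h : X -> R) l :
  (forall a, In a l -> g a = h a) -> sumf g l = sumf h l.
Proof. intros H; unfold sumf; f_equal; now apply map_ext_in. Qed.

Lemma sumf_plus {X} (g h : X -> R) l : sumf (fun a => g a + h a) l = sumf g l + sumf h l.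
Proof.
  induction l as [|a l IH]; [unfold sumf; simpl; lra|].
  rewrite !sumf_cons, IH; lra.
Qed.

Lemma sumf_scal {X} c (g : X -> R) l : sumf (fun a => c * g a) l = c * sumf g l.
Proof.
  induction l as [|a l IH]; [unfold sumf; simpl; lra|].
  rewrite !sumf_cons, IH; lra.
Qed.

Lemma sumf_const {X} c (l : list X) : sumf (fun _ => c) l = INR (length l) * c.
Proof.
  induction l as [|a l IH]; [unfold sumf; simpl; lra|].
  rewrite sumf_cons, IH; simpl length; rewrite S_INR; lra.
Qed.

Lemma sumf_ge0 {X} (g : X -> R) l : (forall a, In a l -> 0 <= g a) -> 0 <= sumf g l.
Proof.
  intros H. replace 0 with (sumf (fun _ : X => 0) l).
  - now apply sumf_le.
  - rewrite sumf_const; lra.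
Qed.

Lemma sumf_term_le {X} (g : X -> R) l a :
  (forall b, In b l -> 0 <= g b) -> In a l -> g a <= sumf g l.
Proof.
  induction l as [|b l IH]; intros H Ha; [contradiction|].
  rewrite sumf_cons.
  assert (0 <= sumf g l) by (apply sumf_ge0; intros; apply H; now right).
  assert (0 <= g b) by (apply H; now left).
  destruct Ha as [->|Ha]; [lra|].
  assert (g a <= sumf g l) by (apply IH; auto; intros; apply H; now right). lra.
Qed.

(** The oracle's point vanishes off the arrived items; this turns its sums over all of U into sums
    over the arrived list. *)
Lemma sumf_support (g : nat -> R) l L :
  NoDup l -> NoDup L -> incl l L -> (forall a, In a L -> ~ In a l -> g a = 0) ->
  sumf g L = sumf g l.
Proof.
  revert L; induction l as [|a l IH]; intros L Hl HL Hi H0.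
  - rewrite (sumf_ext g (fun _ => 0)); [rewrite sumf_const; unfold sumf; simpl; lra|].
    intros b Hb; apply H0; auto.
  - inversion Hl as [|? ? Ha Hl']; subst.
    destruct (in_split a L (Hi a (or_introl eq_refl))) as (L1 & L2 & ->).
    rewrite (sumf_perm g (L1 ++ a :: L2) (a :: (L1 ++ L2)))
      by (symmetry; apply Permutation_middle).
    assert (Hn := NoDup_remove_2 _ _ _ HL).
    rewrite !sumf_cons; f_equal. apply IH; auto.
    + eapply NoDup_remove_1; eauto.
    + intros b Hb. assert (Hb' : In b (L1 ++ a :: L2)) by (apply Hi; now right).
      rewrite in_app_iff in *; simpl in Hb'. destruct Hb' as [|[|]]; auto. subst; contradiction.
    + intros b Hb Hnb. apply H0.
      * rewrite in_app_iff in *; simpl; tauto.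
      * simpl; intros [->|]; auto.
Qed.

(** * Sets of items *)

Definition set0 : nat -> bool := fun _ => false.
(** Has the very shape of the arrived set inside [step], as [add] has that of the updated solution,
    so that runs unfold to these by conversion. *)
Definition mem (l : list nat) : nat -> bool := fun i => existsb (Nat.eqb i) l.
Definition add (y : nat -> bool) (j : nat) : nat -> bool := fun i => orb (y i) (Nat.eqb i j).
Definition setu (y z : nat -> bool) : nat -> bool := fun i => orb (y i) (z i).
Definition rem (y : nat -> bool) (j : nat) : nat -> bool := fun i => andb (y i) (negb (Nat.eqb i j)).
Definition incls (y z : nat -> bool) : Prop := forall i, y i = true -> z i = true.

Lemma mem_spec l i : mem l i = true <-> In i l.
Proof.
  unfold mem; rewrite existsb_exists; split.
  - intros (x & Hx & E). apply Nat.eqb_eq in E; now subst.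
  - intros H; exists i; split; auto. apply Nat.eqb_refl.
Qed.

Lemma mem_spec_false l i : mem l i = false <-> ~ In i l.
Proof. rewrite <- mem_spec; destruct (mem l i); split; intuition congruence. Qed.

(** An equality of functions, because the oracle takes the set as a function: it cannot see the
    order in which the elements arrived. *)
Lemma mem_perm l l' : Permutation l l' -> mem l = mem l'.
Proof.
  intros H; apply functional_extensionality; intros i.
  destruct (mem l' i) eqn:E.
  - apply mem_spec; apply mem_spec in E. eapply Permutation_in; [symmetry|]; eauto.
  - apply mem_spec_false; apply mem_spec_false in E; intro K; apply E.
    eapply Permutation_in; eauto.
Qed.

Ltac setsolve :=
  repeat match goal with |- context [Nat.eqb ?a ?b] => destruct (Nat.eqb_spec a b) end;
  subst; repeat match goal with
  | |- context [existsb ?g ?l] => destruct (existsb g l) eqn:?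
  | |- context [mem ?l ?i] => destruct (mem l i) eqn:?
  | |- context [?y ?i] => is_var y;
    match type of (y i) with bool => destruct (y i) eqn:? end end;
  simpl in *; try congruence; auto.

Lemma add_comm y i j : add (add y i) j = add (add y j) i.
Proof. apply functional_extensionality; intros k; unfold add; setsolve. Qed.

Lemma setu_add_l y z j : setu (add y j) z = add (setu y z) j.
Proof. apply functional_extensionality; intros k; unfold add, setu; setsolve. Qed.

Lemma setu_add_r y z j : setu y (add z j) = add (setu y z) j.
Proof. apply functional_extensionality; intros k; unfold add, setu; setsolve. Qed.

Lemma setu_set0_l y : setu set0 y = y.
Proof. reflexivity. Qed.

Lemma setu_set0_r y : setu y set0 = y.
Proof. apply functional_extensionality; intros k; unfold set0, setu; setsolve. Qed.

Lemma mem_cons j l : mem (j :: l) = add (mem l) j.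
Proof. apply functional_extensionality; intros k; unfold mem, add; simpl; setsolve. Qed.

Lemma incls_add y j : incls y (add y j).
Proof. intros i H; unfold add; now rewrite H. Qed.

Lemma setu_incls_r y z : incls z (setu y z).
Proof. intros i H; unfold setu; rewrite H; apply Bool.orb_true_r. Qed.

Lemma setu_incls_l y z : incls y (setu y z).
Proof. intros i H; unfold setu; now rewrite H. Qed.

(** * Monotone submodular functions and their multilinear extension *)

Definition mono (h : (nat -> bool) -> R) : Prop := forall y z, incls y z -> h y <= h z.
(** [j] may lie in [z]: then the left side is zero and the inequality is an instance of
    monotonicity. *)
Definition dimret (h : (nat -> bool) -> R) : Prop :=
  forall y z j, incls y z -> h (add z j) - h z <= h (add y j) - h y.

(* The expectation of [h (Y ∪ Q)] when [Q] contains each [i] of [is] independently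
   with probability [x i]. *)
Fixpoint EB (is : list nat) (x : nat -> R) (h : (nat -> bool) -> R) (Y : nat -> bool) : R :=
  match is with
  | nil => h Y
  | i :: is' => x i * EB is' x h (add Y i) + (1 - x i) * EB is' x h Y
  end.

Definition in01 (x : nat -> R) (l : list nat) : Prop := forall i, In i l -> 0 <= x i <= 1.

Lemma in01_cons x i l : in01 x (i :: l) -> 0 <= x i <= 1 /\ in01 x l.
Proof. unfold in01; simpl; split; auto. Qed.

Lemma EB_le is x h h' Y : in01 x is -> (forall Z, h Z <= h' Z) -> EB is x h Y <= EB is x h' Y.
Proof.
  intros Hx H; revert Y; induction is as [|i is IH]; intros Y; [apply H|].
  apply in01_cons in Hx as [Hi Hx]; simpl.
  pose proof (IH Hx Y); pose proof (IH Hx (add Y i)). nra.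
Qed.

Lemma EB_scal is x c h Y : EB is x (fun Z => c * h Z) Y = c * EB is x h Y.
Proof.
  revert Y; induction is as [|i is IH]; intros Y; [reflexivity|].
  simpl; rewrite !IH; ring.
Qed.

Lemma EB_minus is x h h' Y :
  EB is x (fun Z => h Z - h' Z) Y = EB is x h Y - EB is x h' Y.
Proof.
  revert Y; induction is as [|i is IH]; intros Y; [reflexivity|].
  simpl; rewrite !IH; ring.
Qed.

Lemma EB_sumf {X} is x (h : X -> (nat -> bool) -> R) l Y :
  EB is x (fun Z => sumf (fun a => h a Z) l) Y = sumf (fun a => EB is x (h a) Y) l.
Proof.
  revert Y; induction is as [|i is IH]; intros Y; [reflexivity|].
  simpl; rewrite !IH, sumf_plus, !sumf_scal; ring.
Qed.

Lemma EB_add is x h Y j : EB is x (fun Z => h (add Z j)) Y = EB is x h (add Y j).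
Proof.
  revert Y; induction is as [|i is IH]; intros Y; [reflexivity|].
  simpl; rewrite !IH, (add_comm Y i j); ring.
Qed.

Lemma EB_anti_base is x h Y Y' :
  in01 x is -> (forall y z, incls y z -> h z <= h y) -> incls Y Y' ->
  EB is x h Y' <= EB is x h Y.
Proof.
  intros Hx Hh; revert Y Y'; induction is as [|i is IH]; intros Y Y' H; [now apply Hh|].
  apply in01_cons in Hx as [Hi Hx]; simpl.
  pose proof (IH Hx Y Y' H).
  assert (incls (add Y i) (add Y' i)).
  { intros k; unfold add; intros E; apply Bool.orb_true_iff in E as [E|E].
    - now rewrite (H _ E).
    - rewrite E; apply Bool.orb_true_r. }
  pose proof (IH Hx _ _ H1). nra.
Qed.

(** Raising the weight of [i] moves mass from [Y] to [add Y i], where an antitone [h] has a smaller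
    expectation. It is applied with [h] a marginal gain. *)
Lemma EB_anti_weights is x x' h Y :
  in01 x is -> in01 x' is -> (forall i, In i is -> x i <= x' i) ->
  (forall y z, incls y z -> h z <= h y) ->
  EB is x' h Y <= EB is x h Y.
Proof.
  intros Hx Hx' Hle Hh; revert Y; induction is as [|i is IH]; intros Y; [apply Rle_refl|].
  apply in01_cons in Hx as [Hi Hx]; apply in01_cons in Hx' as [Hi' Hx']; simpl.
  assert (IH' : forall Y, EB is x' h Y <= EB is x h Y)
    by (intros; apply IH; auto; intros; apply Hle; now right).
  pose proof (Hle i (or_introl eq_refl)).
  pose proof (IH' Y); pose proof (IH' (add Y i)).
  pose proof (EB_anti_base is x h Y (add Y i) Hx Hh (incls_add _ _)). nra.
Qed.

(** Concavity of the multilinear extension along a nonnegative ray: thinning the random set can only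
    raise the expected marginal gain [dd] of an item. *)
Lemma EB_scale_ge is x h lam Y :
  dimret h -> in01 x is -> 0 <= lam <= 1 ->
  lam * EB is x h Y + (1 - lam) * h Y <= EB is (fun i => lam * x i) h Y.
Proof.
  intros Hd Hx Hl; revert Y; induction is as [|i is IH]; intros Y; simpl; [lra|].
  assert (Hx2 := Hx).
  apply in01_cons in Hx as [Hi Hx].
  set (dd := fun Z => h (add Z i) - h Z).
  assert (E : forall w, EB is w dd Y = EB is w h (add Y i) - EB is w h Y)
    by (intros w; unfold dd; now rewrite EB_minus, EB_add).
  assert (EB is x dd Y <= EB is (fun k => lam * x k) dd Y).
  { apply EB_anti_weights; auto.
    - intros k Hk; specialize (Hx k Hk); nra.
    - intros k Hk; specialize (Hx k Hk); nra.
    - intros y z Hyz; unfold dd; now apply Hd. }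
  rewrite !E in H.
  pose proof (IH Hx Y).
  assert (0 <= lam * x i) by nra.
  (* The middle term takes the base value at weights [lam * x] but the marginal gain of [i] at the
     larger weights [x]. *)
  apply Rle_trans with
    (EB is (fun k => lam * x k) h Y + lam * x i * (EB is x h (add Y i) - EB is x h Y)); nra.
Qed.

(** The drawn items join the union of [W] and [Y] one at a time; by diminishing returns each gains
    at most what it gains over [W] alone. *)
Lemma EB_le_marginals is x h W Y :
  mono h -> dimret h -> in01 x is ->
  EB is x h Y <= h (setu W Y) + sumf (fun j => x j * (h (add W j) - h W)) is.
Proof.
  intros Hm Hd Hx; revert Y; induction is as [|i is IH]; intros Y; simpl.
  - unfold sumf; simpl. pose proof (Hm Y (setu W Y) (setu_incls_r _ _)); lra.
  - apply in01_cons in Hx as [Hi Hx].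
    rewrite sumf_cons.
    pose proof (IH Hx Y); pose proof (IH Hx (add Y i)).
    rewrite setu_add_r in H0.
    pose proof (Hd W (setu W Y) i (setu_incls_l _ _)). nra.
Qed.

(** * Restricting a fractional point to a subset of the items *)

Definition restr (x : nat -> R) (l : list nat) : nat -> R := fun i => if mem l i then x i else 0.
Definition inter (Z : nat -> bool) (l : list nat) : nat -> bool := fun i => andb (Z i) (mem l i).

(** Sampling from the restricted point is sampling from [x] and intersecting with [l]. This couples
    all restrictions on one random set, so that they can be compared pointwise. *)
Lemma EB_restr is x h l Y :
  EB is (restr x l) h (inter Y l) = EB is x (fun Z => h (inter Z l)) Y.
Proof.
  revert Y; induction is as [|i is IH]; intros Y; [reflexivity|].
  simpl; rewrite <- !IH. unfold restr at 1 3.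
  destruct (mem l i) eqn:E.
  - replace (inter (add Y i) l) with (add (inter Y l) i); [reflexivity|].
    apply functional_extensionality; intros k; unfold inter, add.
    destruct (Nat.eqb_spec k i); [subst; rewrite E; setsolve|setsolve].
  - replace (inter (add Y i) l) with (inter Y l); [ring|].
    apply functional_extensionality; intros k; unfold inter, add.
    destruct (Nat.eqb_spec k i); [subst; rewrite E; setsolve|setsolve].
Qed.

(* The losses from removing the elements of [l] one at a time telescope, and by
   submodularity each is at least the loss of removing that element alone. *)
Lemma sum_removals h l X :
  dimret h -> (forall Z, 0 <= h Z) -> NoDup l ->
  sumf (fun j => h X - h (rem X j)) l <= h X.
Proof.
  intros Hd H0 Hl.
  assert (G : sumf (fun j => h X - h (rem X j)) l
              <= h X - h (fun i => andb (X i) (negb (mem l i)))).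
  { clear H0; induction l as [|j l IH].
    - replace (fun i => andb (X i) (negb (mem [] i))) with X; [unfold sumf; simpl; lra|].
      apply functional_extensionality; intros k; unfold mem; simpl; setsolve.
    - inversion Hl as [|? ? Hj Hl']; subst. specialize (IH Hl'). rewrite sumf_cons.
      set (P := fun i => andb (X i) (negb (mem l i))) in *.
      set (Q := fun i => andb (X i) (negb (mem (j :: l) i))).
      (* If [j] lies in [X], its marginal gain over the smaller set [Q] is at least the one over
         [rem X j]; otherwise removing it changes nothing. *)
      destruct (X j) eqn:E.
      + assert (EX : add (rem X j) j = X).
        { apply functional_extensionality; intros k; unfold add, rem.
          destruct (Nat.eqb_spec k j); subst; [rewrite E; reflexivity|setsolve]. }
        assert (EP : add Q j = P).
        { apply functional_extensionality; intros k; unfold Q, P, add.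
          apply mem_spec_false in Hj. unfold mem in *; simpl.
          destruct (Nat.eqb_spec k j); subst; [rewrite E, Hj; reflexivity|setsolve]. }
        assert (HI : incls Q (rem X j)).
        { intros k; unfold Q, rem, mem; simpl; setsolve. }
        pose proof (Hd Q (rem X j) j HI) as HH. rewrite EX, EP in HH. lra.
      + assert (EX : rem X j = X).
        { apply functional_extensionality; intros k; unfold rem.
          destruct (Nat.eqb_spec k j); subst; [rewrite E; reflexivity|setsolve]. }
        assert (EP : Q = P).
        { apply functional_extensionality; intros k; unfold Q, P.
          unfold mem; simpl.
          destruct (Nat.eqb_spec k j); subst; [rewrite E; reflexivity|setsolve]. }
        rewrite EX, EP; lra. }
  pose proof (H0 (fun i => andb (X i) (negb (mem l i)))). lra.
Qed.

Definition del (j : nat) (l : list nat) : list nat := remove Nat.eq_dec j l.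

Lemma del_perm j l : NoDup l -> In j l -> Permutation l (j :: del j l).
Proof.
  unfold del; induction l as [|a l IH]; intros Hl Hj; [contradiction|].
  inversion Hl as [|? ? Ha Hl']; subst. simpl.
  destruct (Nat.eq_dec j a) as [->|Hne].
  - now rewrite notin_remove.
  - destruct Hj as [->|Hj]; [congruence|].
    rewrite perm_swap. constructor. now apply IH.
Qed.

Lemma del_nodup j l : NoDup l -> NoDup (del j l).
Proof.
  unfold del; induction l as [|a l IH]; intros Hl; [constructor|].
  inversion Hl as [|? ? Ha Hl']; subst. simpl. destruct (Nat.eq_dec j a); auto.
  constructor; auto. intro H; apply in_remove in H; tauto.
Qed.

Lemma del_length j l k : NoDup l -> In j l -> length l = S k -> length (del j l) = k.
Proof.
  intros Hl Hj E. pose proof (Permutation_length (del_perm j l Hl Hj)); simpl in *; lia.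
Qed.

Lemma del_incl j l L : incl l L -> incl (del j l) L.
Proof. intros H i Hi; apply in_remove in Hi; now apply H. Qed.

(** Deleting a uniform element of [l] costs on average at most a fraction 1/(k+1) of the value:
    [sum_removals] applies to every outcome of the coupled random set. *)
Lemma EB_restr_del is x h l k :
  dimret h -> (forall Z, 0 <= h Z) -> in01 x is -> NoDup l -> length l = S k ->
  INR k * EB is (restr x l) h set0 <= sumf (fun j => EB is (restr x (del j l)) h set0) l.
Proof.
  intros Hd H0 Hx Hl Hk.
  assert (E : forall l', EB is (restr x l') h set0 = EB is x (fun Z => h (inter Z l')) set0)
    by (intros l'; rewrite <- EB_restr; reflexivity).
  rewrite E, (sumf_ext _ (fun j => EB is x (fun Z => h (inter Z (del j l))) set0))
    by (intros; apply E).
  rewrite <- EB_sumf, <- EB_scal. apply EB_le; auto. intros Z.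
  pose proof (sum_removals h l (inter Z l) Hd H0 Hl) as HS.
  rewrite (sumf_ext _ (fun j => h (inter Z l) + (-1) * h (rem (inter Z l) j))) in HS
    by (intros; ring).
  rewrite sumf_plus, sumf_scal, sumf_const, Hk, S_INR in HS.
  rewrite (sumf_ext (fun j => h (inter Z (del j l))) (fun j => h (rem (inter Z l) j))); [lra|].
  intros j Hj. f_equal. apply functional_extensionality; intros i.
  unfold inter, rem. rewrite (mem_perm l (j :: del j l)) by now apply del_perm.
  assert (mem (del j l) j = false)
    by (apply mem_spec_false; unfold del; apply remove_In).
  unfold mem in *; simpl; destruct (Nat.eqb_spec i j); subst; setsolve.
Qed.

(** * From Boolean lists to predicates, and the multilinear extension as [EB] *)

Definition setfun (n : nat) (f : list bool -> R) (Y : nat -> bool) : R := f (map Y (seq 0 n)).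

Lemma memb_map_seq (Y : nat -> bool) n i : (i < n)%nat -> memb (map Y (seq 0 n)) i = Y i.
Proof.
  intros H; unfold memb.
  rewrite (nth_indep _ false (Y 0%nat)) by (rewrite length_map, length_seq; lia).
  rewrite map_nth, seq_nth; auto.
Qed.

Lemma length_map_seq (Y : nat -> bool) n : length (map Y (seq 0 n)) = n.
Proof. now rewrite length_map, length_seq. Qed.

Lemma setfun_mono n f : monotone_setfun n f -> mono (setfun n f).
Proof.
  intros Hm Y Z H; apply Hm; try apply length_map_seq.
  intros i Hi; rewrite !memb_map_seq by auto; apply H.
Qed.

(** Submodularity is applied to [add Y j] and [Z]. Their union is [add Z j]; their intersection
    contains [Y], possibly together with [j], so monotonicity closes the gap. *)
Lemma setfun_dimret n f :
  monotone_setfun n f -> submodular_setfun n f -> dimret (setfun n f).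
Proof.
  intros Hm Hs Y Z j H.
  pose proof (Hs (map (add Y j) (seq 0 n)) (map Z (seq 0 n))
                 (length_map_seq _ _) (length_map_seq _ _)) as HH.
  assert (EU : setU n (map (add Y j) (seq 0 n)) (map Z (seq 0 n)) = map (add Z j) (seq 0 n)).
  { apply map_ext_in; intros i Hi; apply in_seq in Hi.
    rewrite !memb_map_seq by lia. unfold add. specialize (H i).
    destruct (Y i), (Z i), (Nat.eqb i j); auto; discriminate (H eq_refl). }
  assert (HI : setfun n f Y <= f (setI n (map (add Y j) (seq 0 n)) (map Z (seq 0 n)))).
  { apply Hm; try apply length_map_seq; unfold setI.
    intros i Hi E. rewrite memb_map_seq in E by auto.
    rewrite (memb_map_seq (fun i => andb (memb (map (add Y j) (seq 0 n)) i)
              (memb (map Z (seq 0 n)) i))) by auto.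
    rewrite !memb_map_seq by auto. unfold add. now rewrite E, (H i E). }
  rewrite EU in HH. unfold setfun in *; lra.
Qed.

Lemma allbools_length n cs : In cs (allbools n) -> length cs = n.
Proof.
  revert cs; induction n as [|n IH]; simpl; intros cs H.
  - destruct H as [<-|[]]; reflexivity.
  - apply in_app_iff in H as [H|H]; apply in_map_iff in H as (c & <- & Hc);
      simpl; f_equal; auto.
Qed.

(** Places a Boolean list at the positions from [s] on; the offset serves the induction over
    [seq s k]. *)
Definition shift (s : nat) (Rs : list bool) : nat -> bool :=
  fun i => andb (Nat.leb s i) (memb Rs (i - s)).

Lemma setu_shift_cons Y s c Rs :
  setu Y (shift s (c :: Rs)) = setu (if c then add Y s else Y) (shift (S s) Rs).
Proof.
  apply functional_extensionality; intros i; unfold setu, shift, memb.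
  destruct (Nat.eq_dec i s) as [->|Hne].
  - rewrite Nat.sub_diag, (proj2 (Nat.leb_le s s)), (proj2 (Nat.leb_gt (S s) s)) by lia.
    unfold add; destruct c; simpl; rewrite ?Nat.eqb_refl; destruct (Y s); reflexivity.
  - replace (Nat.leb s i) with (Nat.leb (S s) i)
      by (destruct (Nat.leb_spec (S s) i), (Nat.leb_spec s i); auto; lia).
    replace ((if c then add Y s else Y) i) with (Y i)
      by (destruct c; auto; unfold add; rewrite (proj2 (Nat.eqb_neq i s) Hne);
          destruct (Y i); auto).
    destruct (Nat.leb_spec (S s) i); simpl; auto.
    replace (i - s)%nat with (S (i - S s)) by lia. reflexivity.
Qed.

Lemma sum_allbools_EB k s x h Y :
  sumf (fun Rs => h (setu Y (shift s Rs)) *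
          prodR (map (fun i => if memb Rs (i - s) then x i else 1 - x i) (seq s k)))
       (allbools k)
  = EB (seq s k) x h Y.
Proof.
  revert s Y; induction k as [|k IH]; intros s Y.
  - simpl. unfold sumf; simpl. replace (setu Y (shift s [])) with Y; [ring|].
    apply functional_extensionality; intros i; unfold setu, shift, memb.
    destruct (i - s)%nat; simpl; now rewrite Bool.andb_false_r, Bool.orb_false_r.
  - simpl. rewrite sumf_app, !sumf_map.
    rewrite <- (IH (S s) Y), <- (IH (S s) (add Y s)), <- !sumf_scal.
    assert (G : forall c Rs,
      map (fun i => if memb (c :: Rs) (i - s) then x i else 1 - x i) (seq (S s) k)
      = map (fun i => if memb Rs (i - S s) then x i else 1 - x i) (seq (S s) k)).
    { intros c Rs; apply map_ext_in; intros i Hi; apply in_seq in Hi.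
      replace (i - s)%nat with (S (i - S s)) by lia. reflexivity. }
    f_equal; apply sumf_ext; intros Rs _;
      rewrite setu_shift_cons, G, Nat.sub_diag; simpl; ring.
Qed.

Lemma multilin_EB n f x : multilin n f x = EB (seq 0 n) x (setfun n f) set0.
Proof.
  rewrite <- sum_allbools_EB. apply sumf_ext; intros Rs HR.
  f_equal.
  - unfold setfun. apply f_equal. pose proof (allbools_length n Rs HR) as HL.
    apply nth_ext with (d := false) (d' := false); [now rewrite length_map_seq|].
    intros i Hi. rewrite HL in Hi. rewrite setu_set0_l.
    fold (memb (map (shift 0 Rs) (seq 0 n)) i).
    rewrite memb_map_seq by auto. unfold shift. simpl. now rewrite Nat.sub_0_r.
  - f_equal. apply map_ext; intros i. now rewrite Nat.sub_0_r.
Qed.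

(** * Generating the random order backwards *)

(* Conditioned on the set [l] of the first [k] arrivals, the [k]-th item [j] is uniform in
   [l], and the first [k-1] rounds play on [l \ j] independently of [j].  The history passed
   to [h] lists the tentatively selected items, the latest first. *)
Fixpoint Ex (O : nat -> (nat -> bool) -> nat -> R) (k : nat) (l : list nat)
    (h : list nat -> R) : R :=
  match k with
  | 0%nat => h nil
  | S k' => / INR (S k') *
      sumf (fun j => O (S k') (mem l) j * Ex O k' (del j l) (fun t => h (j :: t))
                     + (1 - O (S k') (mem l) j) * Ex O k' (del j l) h) l
  end.

Lemma Ex_S O k l h :
  Ex O (S k) l h = / INR (S k) *
    sumf (fun j => O (S k) (mem l) j * Ex O k (del j l) (fun t => h (j :: t))
                   + (1 - O (S k) (mem l) j) * Ex O k (del j l) h) l.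
Proof. reflexivity. Qed.

(** The head is the latest item, so the recursion settles the earlier picks first, as the algorithm
    does. *)
Fixpoint accepted (n m : nat) (A : nat -> nat -> R) (b : nat -> R) (t : list nat) : nat -> bool :=
  match t with
  | nil => set0
  | j :: t' => let y := accepted n m A b t' in
               if int_feasibleb n m A b (add y j) then add y j else y
  end.

(** * Random orders and coins grouped by the last round *)

Lemma insert_all_In a l s :
  In s (insert_all a l) <-> exists l1 l2, l = l1 ++ l2 /\ s = l1 ++ a :: l2.
Proof.
  revert s; induction l as [|h t IH]; simpl; intros s; split.
  - intros [<-|[]]; exists [], []; auto.
  - intros (l1 & l2 & E & ->). symmetry in E; apply app_eq_nil in E as [-> ->]; auto.
  - intros [<-|H]; [exists [], (h :: t); auto|].
    apply in_map_iff in H as (s' & <- & H). apply IH in H as (l1 & l2 & -> & ->).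
    exists (h :: l1), l2; auto.
  - intros (l1 & l2 & E & ->). destruct l1 as [|h' l1]; simpl in *.
    + left; now rewrite <- E.
    + injection E as <- E. right; apply in_map; apply IH; eauto.
Qed.

Lemma perms_In l s : In s (perms l) <-> Permutation l s.
Proof.
  revert s; induction l as [|h t IH]; simpl; intros s; split.
  - intros [<-|[]]; auto.
  - intros H; apply Permutation_nil in H; auto.
  - intros H; apply in_flat_map in H as (s' & Hs' & H).
    apply insert_all_In in H as (l1 & l2 & -> & ->). apply IH in Hs'.
    now apply Permutation_cons_app.
  - intros H. destruct (in_split h s) as (l1 & l2 & ->).
    { eapply Permutation_in; eauto; now left. }
    apply in_flat_map. exists (l1 ++ l2); split.
    + apply IH. eapply Permutation_cons_app_inv; eauto.
    + apply insert_all_In; eauto.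
Qed.

Lemma insert_all_nodup a l : ~ In a l -> NoDup (insert_all a l).
Proof.
  induction l as [|h t IH]; simpl; intros H; [repeat constructor; simpl; tauto|].
  constructor.
  - intros K; apply in_map_iff in K as (s & E & _). injection E as -> _. tauto.
  - apply FinFun.Injective_map_NoDup; [intros u v E; congruence|]. apply IH; tauto.
Qed.

Lemma NoDup_flat_map {X Y} (g : X -> list Y) l :
  NoDup l -> (forall a, In a l -> NoDup (g a)) ->
  (forall a a' y, In a l -> In a' l -> In y (g a) -> In y (g a') -> a = a') ->
  NoDup (flat_map g l).
Proof.
  induction l as [|a l IH]; intros Hl Hg Hd; simpl; [constructor|].
  inversion Hl as [|? ? Ha Hl']; subst.
  apply NoDup_app; [apply Hg; now left|apply IH; auto|].
  - intros; apply Hg; now right.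
  - intros u v y Hu Hv; apply Hd; now right.
  - intros y Hy K. apply in_flat_map in K as (a' & Ha' & Hy').
    rewrite (Hd a a' y) in Ha; auto; [now left|now right].
Qed.

Lemma perms_nodup l : NoDup l -> NoDup (perms l).
Proof.
  induction l as [|h t IH]; intros Hl; [repeat constructor; simpl; tauto|].
  inversion Hl as [|? ? Hh Ht]; subst. simpl.
  assert (Hn : forall s, In s (perms t) -> ~ In h s).
  { intros s Hs K; apply Hh. apply perms_In in Hs.
    eapply Permutation_in; [symmetry|]; eauto. }
  apply NoDup_flat_map; auto.
  - intros s Hs; apply insert_all_nodup; auto.
  - intros s s' y Hs Hs' Hy Hy'.
    apply insert_all_In in Hy as (l1 & l2 & -> & ->).
    apply insert_all_In in Hy' as (l1' & l2' & -> & E).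
    (* Deleting [h] undoes its insertion, so insertions into distinct permutations never
       coincide. *)
    assert (R : forall u v, In (u ++ v) (perms t) ->
                remove Nat.eq_dec h (u ++ h :: v) = u ++ v).
    { intros u v Huv. apply Hn in Huv.
      rewrite remove_app. simpl. destruct (Nat.eq_dec h h); [|congruence].
      rewrite <- remove_app. now apply notin_remove. }
    rewrite <- (R l1 l2 Hs), <- (R l1' l2' Hs'). now rewrite E.
Qed.

(** A uniform order of [l] is a uniform last item preceded by a uniform order of the rest. Both
    lists are free of repetitions, so equal membership suffices. *)
Lemma perms_by_last l : NoDup l -> l <> nil ->
  Permutation (perms l) (flat_map (fun j => map (fun s => s ++ [j]) (perms (del j l))) l).
Proof.
  intros Hl Hne. apply NoDup_Permutation.
  - now apply perms_nodup.
  - apply NoDup_flat_map; auto.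
    + intros j Hj. apply FinFun.Injective_map_NoDup.
      * intros u v E; now apply app_inj_tail in E.
      * apply perms_nodup, del_nodup, Hl.
    + intros j j' y _ _ Hy Hy'.
      apply in_map_iff in Hy as (u & <- & _). apply in_map_iff in Hy' as (v & E & _).
      now apply app_inj_tail in E.
  - intros s; rewrite perms_In, in_flat_map; split.
    + intros H. destruct (exists_last (l := s)) as (s' & j & ->).
      { intros ->; symmetry in H; apply Permutation_nil in H; auto. }
      assert (Hj : In j l).
      { eapply Permutation_in; [symmetry; exact H|]. rewrite in_app_iff; simpl; tauto. }
      exists j; split; auto. apply (in_map (fun s => s ++ [j])), perms_In.
      apply Permutation_cons_inv with j. rewrite <- del_perm by auto.
      rewrite H. symmetry. apply Permutation_cons_append.
    + intros (j & Hj & H). apply in_map_iff in H as (s' & <- & H). apply perms_In in H.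
      rewrite (del_perm j l), H by auto. apply Permutation_cons_append.
Qed.

Lemma sum_allbools_last k g :
  sumf g (allbools (S k)) = sumf (fun cs => g (cs ++ [true]) + g (cs ++ [false])) (allbools k).
Proof.
  revert g; induction k as [|k IH]; intros g.
  - unfold sumf; simpl; ring.
  - change (allbools (S (S k))) with
      (map (cons true) (allbools (S k)) ++ map (cons false) (allbools (S k))).
    rewrite sumf_app, !sumf_map, (IH (fun cs => g (true :: cs))), (IH (fun cs => g (false :: cs))).
    change (allbools (S k)) with (map (cons true) (allbools k) ++ map (cons false) (allbools k)).
    rewrite sumf_app, !sumf_map. reflexivity.
Qed.

(** * Runs of the algorithm as backward expectations *)

Section Run.
Variables (n m : nat) (A : nat -> nat -> R) (b : nat -> R)
  (O : nat -> (nat -> bool) -> nat -> R).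

Lemma go_snoc sigma l cs c st :
  go n m A b O sigma l (cs ++ [c]) st =
  step n m A b O sigma (l + length cs) c (go n m A b O sigma l cs st).
Proof.
  revert l st; induction cs as [|c' cs IH]; intros l st; simpl.
  - now rewrite Nat.add_0_r.
  - rewrite IH. f_equal. lia.
Qed.

(** The algorithm is online: rounds within the length of [sigma] see nothing of [tau]. *)
Lemma go_prefix sigma tau l cs st :
  (0 < l)%nat -> (l + length cs <= S (length sigma))%nat ->
  go n m A b O (sigma ++ tau) l cs st = go n m A b O sigma l cs st.
Proof.
  revert l st; induction cs as [|c cs IH]; intros l st Hl H; [reflexivity|].
  simpl in *. rewrite IH by lia. f_equal. unfold step.
  rewrite app_nth1 by lia.
  replace (firstn l (sigma ++ tau)) with (firstn l sigma); [reflexivity|].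
  rewrite firstn_app. replace (l - length sigma)%nat with 0%nat by lia.
  simpl. now rewrite app_nil_r.
Qed.

Lemma run_snoc s j cs c : length cs = length s ->
  run n m A b O (s ++ [j]) (cs ++ [c]) =
  (let (y, pr) := run n m A b O s cs in
   let p := O (S (length s)) (mem (s ++ [j])) j in
   if c then (if int_feasibleb n m A b (add y j) then add y j else y, pr * p)
   else (y, pr * (1 - p))).
Proof.
  intros E; unfold run. rewrite go_snoc, go_prefix by lia.
  unfold step. replace (1 + length cs)%nat with (S (length s)) by lia.
  rewrite app_nth2 by lia. replace (S (length s) - 1 - length s)%nat with 0%nat by lia.
  rewrite firstn_all2 by (rewrite length_app; simpl; lia). reflexivity.
Qed.

(** Stated for every [h], because peeling off the last round replaces [h] by its value after that
    round's decision, which is [h1] when the coin is true. *)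
Lemma sum_runs_Ex k : forall l h, NoDup l -> length l = k ->
  sumf (fun s => sumf (fun cs => snd (run n m A b O s cs) * h (fst (run n m A b O s cs)))
                      (allbools k)) (perms l)
  = INR (fact k) * Ex O k l (fun t => h (accepted n m A b t)).
Proof.
  induction k as [|k IH]; intros l h Hl Hk.
  - destruct l; [|discriminate]. unfold sumf, run; simpl. change (fun _ : nat => false) with set0. ring.
  - assert (Hne : l <> nil) by (intros ->; discriminate).
    rewrite (sumf_perm _ _ _ (perms_by_last l Hl Hne)), sumf_flat_map.
    rewrite Ex_S. change (fact (S k)) with (S k * fact k)%nat. rewrite mult_INR.
    assert (INR (S k) <> 0) by (apply not_0_INR; lia).
    replace (INR (S k) * INR (fact k) * (/ INR (S k) * _))
      with (INR (fact k) *
       sumf (fun j => O (S k) (mem l) j * Ex O k (del j l) (fun t => h (accepted n m A b (j :: t)))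
              + (1 - O (S k) (mem l) j) * Ex O k (del j l) (fun t => h (accepted n m A b t))) l)
      by (simpl accepted; field; assumption).
    rewrite <- sumf_scal. apply sumf_ext; intros j Hj.
    rewrite sumf_map.
    set (p := O (S k) (mem l) j).
    set (h1 := fun y => h (if int_feasibleb n m A b (add y j) then add y j else y)).
    assert (Hd := del_nodup j l Hl). assert (Hdl := del_length j l k Hl Hj Hk).
    transitivity (p * (INR (fact k) * Ex O k (del j l) (fun t => h1 (accepted n m A b t)))
      + (1 - p) * (INR (fact k) * Ex O k (del j l) (fun t => h (accepted n m A b t))));
      [|unfold h1; simpl; ring].
    rewrite <- (IH (del j l) h1), <- (IH (del j l) h) by auto.
    rewrite <- !sumf_scal, <- sumf_plus. apply sumf_ext; intros s Hs.
    rewrite sum_allbools_last, <- !sumf_scal, <- sumf_plus. apply sumf_ext; intros cs Hcs.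
    apply perms_In in Hs. apply allbools_length in Hcs.
    assert (length s = k) by (rewrite <- (Permutation_length Hs); auto).
    rewrite !run_snoc by lia.
    rewrite <- (mem_perm l (s ++ [j])), H0
      by (rewrite (del_perm j l), Hs by auto; apply Permutation_cons_append).
    fold p. unfold h1. destruct (run n m A b O s cs) as [y pr]. simpl. ring.
Qed.

Lemma expected_value_Ex f :
  expected_value n m A b f O
  = Ex O n (seq 0 n) (fun t => setfun n f (accepted n m A b t)).
Proof.
  unfold expected_value.
  pose proof (sum_runs_Ex n (seq 0 n) (setfun n f) (seq_NoDup _ _) (length_seq _ _)) as H.
  unfold sumf, setfun in *. rewrite H.
  assert (INR (fact n) <> 0) by apply INR_fact_neq_0.
  field; assumption.
Qed.

Lemma run_feasible sigma cs :
  int_feasible n m A b set0 -> int_feasible n m A b (fst (run n m A b O sigma cs)).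
Proof.
  intros H0. unfold run.
  assert (G : forall l st, int_feasible n m A b (fst st) ->
              int_feasible n m A b (fst (go n m A b O sigma l cs st))).
  { induction cs as [|c cs IH]; intros l st H; simpl; auto.
    apply IH. unfold step. destruct st as [y pr]; simpl in *.
    destruct c; simpl; auto.
    match goal with |- context [if ?c then _ else _] => destruct c eqn:E end; auto.
    intros i Hi. unfold int_feasibleb in E. rewrite forallb_forall in E.
    specialize (E i (proj2 (in_seq _ _ _) (conj (Nat.le_0_l _) Hi))).
    destruct (Rle_dec _ _) in E; [assumption|discriminate]. }
  now apply G.
Qed.

End Run.

(** * Analysis of the backward process *)

Definition arrived (n k : nat) (l : list nat) : Prop :=
  NoDup l /\ length l = k /\ incl l (seq 0 n).

Lemma arrived_del n k l j : arrived n (S k) l -> In j l -> arrived n k (del j l).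
Proof.
  intros (H1 & H2 & H3) Hj; repeat split.
  - now apply del_nodup.
  - now apply del_length.
  - now apply del_incl.
Qed.

Lemma Ex_lin O k l c h h' :
  Ex O k l (fun t => h t + c * h' t) = Ex O k l h + c * Ex O k l h'.
Proof.
  revert l h h'; induction k as [|k IH]; intros l h h'; [reflexivity|].
  rewrite ?Ex_S.
  match goal with |- _ * ?a = _ * ?b + c * (_ * ?d) => replace a with (b + c * d); [ring|] end.
  rewrite <- sumf_scal, <- sumf_plus. apply sumf_ext; intros j _.
  rewrite (IH (del j l) (fun t => h (j :: t)) (fun t => h' (j :: t))), IH. ring.
Qed.

Lemma Ex_0 O k l : Ex O k l (fun _ => 0) = 0.
Proof.
  revert l; induction k as [|k IH]; intros l; [reflexivity|]. rewrite ?Ex_S.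
  rewrite (sumf_ext _ (fun _ => 0)) by (intros; rewrite IH; ring).
  rewrite sumf_const; ring.
Qed.

Lemma Ex_scal O k l c h : Ex O k l (fun t => c * h t) = c * Ex O k l h.
Proof.
  pose proof (Ex_lin O k l c (fun _ => 0) h) as H. rewrite Ex_0 in H.
  replace (fun t => c * h t) with (fun t => 0 + c * h t); [lra|].
  apply functional_extensionality; intros; ring.
Qed.

Lemma Ex_sumf {X} O k l (h : X -> list nat -> R) L :
  Ex O k l (fun t => sumf (fun i => h i t) L) = sumf (fun i => Ex O k l (h i)) L.
Proof.
  induction L as [|i L IH]; [apply Ex_0|].
  rewrite sumf_cons, <- IH.
  replace (Ex O k l (h i) + _) with
    (Ex O k l (h i) + 1 * Ex O k l (fun t => sumf (fun i => h i t) L)) by ring.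
  rewrite <- Ex_lin. f_equal. apply functional_extensionality; intros t.
  rewrite sumf_cons; ring.
Qed.

Section Analysis.
Variables (n m : nat) (A : nat -> nat -> R) (b : nat -> R) (f : list bool -> R)
  (alpha : R) (O : nat -> (nat -> bool) -> nat -> R).
Hypothesis HA : forall i j, (i < m)%nat -> (j < n)%nat -> 0 <= A i j.
Hypothesis Hb : forall i, (i < m)%nat -> 0 < b i.
Hypothesis Hrow : forall i, (i < m)%nat -> 0 < rowmax n A i.
Hypothesis Hf0 : nonneg_setfun n f.
Hypothesis Hfm : monotone_setfun n f.
Hypothesis Hfs : submodular_setfun n f.
Hypothesis Halpha : 0 < alpha <= 1.
Hypothesis HO : oracle_ok n m A b f alpha O.

Let h := setfun n f.
Let acc := accepted n m A b.

Lemma setfun_ge0 Y : 0 <= h Y.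
Proof. apply Hf0, length_map_seq. Qed.

Lemma oracle01 k l j : (j < n)%nat -> 0 <= O k (mem l) j <= 1.
Proof. intros Hj; apply (HO k (mem l)); auto. Qed.

Lemma arrived_lt k l j : arrived n k l -> In j l -> (j < n)%nat.
Proof. intros (_ & _ & H) Hj; apply H, in_seq in Hj; lia. Qed.

Lemma oracle_sum k l (g : nat -> R) : arrived n k l ->
  sumf (fun j => O k (mem l) j * g j) (seq 0 n) = sumf (fun j => O k (mem l) j * g j) l.
Proof.
  intros (H1 & H2 & H3). apply sumf_support; auto using seq_NoDup.
  intros j Hj Hn. apply in_seq in Hj. apply mem_spec_false in Hn.
  destruct (HO k (mem l)) as [(_ & _ & H) _]. rewrite H by (auto; lia). ring.
Qed.

(** The induction step of the lower bounds below: [B j] bounds the branch in which [j] arrives last,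
    and the average of [B] must reach [c]. *)
Lemma Ex_ge k l c h' (B : nat -> R) : arrived n (S k) l ->
  INR (S k) * c <= sumf B l ->
  (forall j, In j l -> B j <= O (S k) (mem l) j * Ex O k (del j l) (fun t => h' (j :: t))
                        + (1 - O (S k) (mem l) j) * Ex O k (del j l) h') ->
  c <= Ex O (S k) l h'.
Proof.
  intros Hl Hc HB.
  pose proof (sumf_le _ _ _ HB) as HH. rewrite ?Ex_S.
  assert (0 < INR (S k)) by (apply lt_0_INR; lia).
  apply Rmult_le_reg_l with (INR (S k)); auto.
  rewrite <- Rmult_assoc, Rinv_r, Rmult_1_l by lra. lra.
Qed.

(** The comparison is only asked for histories inside U, since the row bounds hold for items below
    [n]. *)
Lemma Ex_le k : forall l h1 h2, arrived n k l ->
  (forall t, incl t (seq 0 n) -> h1 t <= h2 t) -> Ex O k l h1 <= Ex O k l h2.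
Proof.
  induction k as [|k IH]; intros l h1 h2 Hl H; [apply H; intros ? []|].
  rewrite ?Ex_S.
  apply Rmult_le_compat_l; [left; apply Rinv_0_lt_compat, lt_0_INR; lia|].
  apply sumf_le; intros j Hj.
  assert (Hj' := arrived_lt _ _ _ Hl Hj).
  assert (Ht := arrived_del _ _ _ _ Hl Hj).
  destruct (oracle01 (S k) l j Hj').
  pose proof (IH _ h1 h2 Ht H).
  assert (Ex O k (del j l) (fun t => h1 (j :: t)) <= Ex O k (del j l) (fun t => h2 (j :: t))).
  { apply IH; auto. intros t Hi; apply H. intros i [<-|Hi']; [apply in_seq; lia|auto]. }
  nra.
Qed.

(** * Exponential moments of the normalised row loads *)

Definition wt (i : nat) (t : list nat) : R := sumf (fun j => A i j / rowmax n A i) t.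

Lemma rowmax_ge i j : (j < n)%nat -> A i j <= rowmax n A i.
Proof.
  unfold rowmax; intros Hj.
  assert (H : In j (seq 0 n)) by (apply in_seq; lia). clear Hj.
  induction (seq 0 n) as [|a L IH]; [contradiction|]. simpl.
  destruct H as [->|H]; [apply Rmax_l|].
  eapply Rle_trans; [apply IH; auto|apply Rmax_r].
Qed.

(** Convexity of exp: the tangent at [c = s * a], evaluated at [s] and at 0 and weighted by [a] and
    [1 - a], gives back [exp c]. *)
Lemma exp_chord s a : 0 <= a <= 1 -> exp (s * a) <= 1 + a * (exp s - 1).
Proof.
  intros Ha. set (c := s * a).
  assert (H1 : exp s = exp c * exp (s - c)) by (rewrite <- exp_plus; f_equal; ring).
  assert (H2 : 1 = exp c * exp (- c)) by (rewrite <- exp_plus, Rplus_opp_r, exp_0; auto).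
  pose proof (exp_ineq1_le (s - c)). pose proof (exp_ineq1_le (- c)).
  assert (0 < exp c) by apply exp_pos.
  assert (exp c * (1 + (s - c)) <= exp s) by (rewrite H1; apply Rmult_le_compat_l; lra).
  assert (exp c * (1 + - c) <= 1) by (rewrite H2 at 2; apply Rmult_le_compat_l; lra).
  replace (exp c) with (a * (exp c * (1 + (s - c))) + (1 - a) * (exp c * (1 + - c)))
    by (unfold c; ring).
  assert (a * (exp c * (1 + (s - c))) <= a * exp s) by (apply Rmult_le_compat_l; lra).
  assert ((1 - a) * (exp c * (1 + - c)) <= (1 - a) * 1) by (apply Rmult_le_compat_l; lra).
  lra.
Qed.

(* Chernoff bound: given the set [l], round [k] consumes in expectation at most [b i / n] of row [i]. *)
Lemma Ex_exp_wt i s : (i < m)%nat -> 0 <= s -> forall k l, arrived n k l ->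
  Ex O k l (fun t => exp (s * wt i t))
  <= exp ((exp s - 1) * (b i / rowmax n A i) * (INR k / INR n)).
Proof.
  intros Hi Hs. set (r := rowmax n A i). set (be := b i / r).
  assert (Hr : 0 < r) by now apply Hrow.
  assert (He : 0 <= exp s - 1) by (pose proof (exp_ineq1_le s); lra).
  induction k as [|k IH]; intros l Hl.
  - simpl. unfold wt, sumf; simpl. rewrite Rmult_0_r, exp_0.
    pose proof (exp_ineq1_le ((exp s - 1) * be * (0 / INR n))). unfold Rdiv in *; lra.
  - set (M := exp ((exp s - 1) * be * (INR k / INR n))) in *.
    assert (HM : 0 < M) by apply exp_pos.
    set (N := INR (S k)). assert (HN : 0 < N) by (apply lt_0_INR; lia).
    (* Feasibility of the oracle's point for the scaled capacity of round [S k], divided by the row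
       maximum. *)
    assert (Hsum : sumf (fun j => O (S k) (mem l) j * (A i j / r)) l <= N / INR n * be).
    { rewrite <- (oracle_sum (S k) l) by auto.
      destruct (HO (S k) (mem l)) as [(_ & Hc & _) _]. specialize (Hc i Hi).
      unfold rowdot, sum_lt in Hc.
      rewrite (sumf_ext _ (fun j => / r * (A i j * O (S k) (mem l) j)))
        by (intros; unfold Rdiv; ring).
      rewrite sumf_scal. unfold be, Rdiv at 2.
      change (sumR (map (fun j => A i j * O (S k) (mem l) j) (seq 0 n)))
        with (sumf (fun j => A i j * O (S k) (mem l) j) (seq 0 n)) in Hc.
      fold N in Hc. replace (N / INR n * (b i * / r)) with (/ r * (N / INR n * b i)) by ring.
      apply Rmult_le_compat_l; auto. left; now apply Rinv_0_lt_compat. }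
    (* Averaging over [N] items cancels the [N] of the scaled capacity, so the round multiplies the
       moment by at most 1 + (exp s - 1) be / n. *)
    apply Rle_trans with (/ N * (M * (N + (exp s - 1) * (N / INR n * be)))).
    + rewrite ?Ex_S. apply Rmult_le_compat_l; [left; now apply Rinv_0_lt_compat|].
      apply Rle_trans with
        (sumf (fun j => M * (1 + (exp s - 1) * (O (S k) (mem l) j * (A i j / r)))) l).
      * apply sumf_le; intros j Hj.
        assert (Hj' := arrived_lt _ _ _ Hl Hj).
        destruct (oracle01 (S k) l j Hj') as [Hp0 Hp1].
        set (p := O (S k) (mem l) j) in *.
        pose proof (IH _ (arrived_del _ _ _ _ Hl Hj)) as HI.
        set (w := A i j / r).
        assert (Hw : 0 <= w <= 1).
        { unfold w; split.
          - apply Rle_mult_inv_pos; auto.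
          - apply Rmult_le_reg_r with r; auto. unfold Rdiv.
            rewrite Rmult_assoc, Rinv_l, Rmult_1_r, Rmult_1_l by lra. now apply rowmax_ge. }
        replace (fun t => exp (s * wt i (j :: t))) with (fun t => exp (s * w) * exp (s * wt i t)).
        2:{ apply functional_extensionality; intros t. unfold wt; rewrite sumf_cons.
            rewrite <- exp_plus. apply f_equal. unfold w, r. ring. }
        rewrite Ex_scal. set (E := Ex O k (del j l) (fun t => exp (s * wt i t))) in *.
        pose proof (exp_chord s w Hw). pose proof (exp_pos (s * w)).
        assert (exp (s * w) * E <= exp (s * w) * M) by (apply Rmult_le_compat_l; lra).
        assert (exp (s * w) * M <= (1 + w * (exp s - 1)) * M) by (apply Rmult_le_compat_r; lra).
        assert (p * (exp (s * w) * E) <= p * ((1 + w * (exp s - 1)) * M))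
          by (apply Rmult_le_compat_l; lra).
        assert ((1 - p) * E <= (1 - p) * M) by (apply Rmult_le_compat_l; lra).
        lra.
      * rewrite sumf_scal, sumf_plus, sumf_const, sumf_scal.
        destruct Hl as (_ & Hlen & _). rewrite Hlen. fold N.
        apply Rmult_le_compat_l; [lra|].
        assert ((exp s - 1) * sumf (fun a => O (S k) (mem l) a * (A i a / r)) l
                <= (exp s - 1) * (N / INR n * be)) by (apply Rmult_le_compat_l; lra).
        lra.
    + replace (/ N * (M * (N + (exp s - 1) * (N / INR n * be))))
        with (M * (1 + (exp s - 1) * be * (1 / INR n)))
        by (unfold Rdiv; rewrite !(Rmult_comm N), <- Rmult_assoc;
            transitivity (M * (/ N * N) * (1 + (exp s - 1) * (/ INR n * be)));
            [rewrite Rinv_l by lra; ring|ring]).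
      replace ((exp s - 1) * be * (N / INR n))
        with ((exp s - 1) * be * (INR k / INR n) + (exp s - 1) * be * (1 / INR n))
        by (unfold N; rewrite S_INR; unfold Rdiv; ring).
      rewrite exp_plus. fold M. apply Rmult_le_compat_l; [lra|apply exp_ineq1_le].
Qed.

(** * Acceptance and the probability that an item is blocked *)

Definition blocked (j : nat) (t : list nat) : R :=
  if int_feasibleb n m A b (add (acc t) j) then 0 else 1.

Lemma int_feasibleb_spec y : int_feasibleb n m A b y = true <-> int_feasible n m A b y.
Proof.
  unfold int_feasibleb, int_feasible. rewrite forallb_forall. split; intros H i Hi.
  - specialize (H i (proj2 (in_seq _ _ _) (conj (Nat.le_0_l _) Hi))).
    destruct (Rle_dec _ _) in H; [assumption|discriminate].
  - apply in_seq in Hi. destruct (Rle_dec _ _); auto. exfalso; apply n0, H; lia.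
Qed.

Lemma rowdot_set0 i : rowdot n A i (indicator set0) = 0.
Proof.
  unfold rowdot, sum_lt. change (sumf (fun j => A i j * indicator set0 j) (seq 0 n) = 0).
  rewrite (sumf_ext _ (fun _ => 0)) by (intros; unfold indicator, set0; simpl; ring).
  rewrite sumf_const; ring.
Qed.

Lemma set0_feasible : int_feasible n m A b set0.
Proof. intros i Hi. rewrite rowdot_set0. left; now apply Hb. Qed.

Lemma accepted_feasible t : int_feasible n m A b (acc t).
Proof.
  induction t as [|j t IH]; [apply set0_feasible|].
  unfold acc in *; simpl.
  destruct (int_feasibleb n m A b (add (accepted n m A b t) j)) eqn:E; auto.
  now apply int_feasibleb_spec.
Qed.

Lemma rowdot_add i y j : (i < m)%nat -> (j < n)%nat ->
  rowdot n A i (indicator (add y j)) <= rowdot n A i (indicator y) + A i j.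
Proof.
  intros Hi Hj. unfold rowdot, sum_lt.
  change (sumf (fun k => A i k * indicator (add y j) k) (seq 0 n) <=
          sumf (fun k => A i k * indicator y k) (seq 0 n) + A i j).
  replace (A i j) with (sumf (fun k => A i k * (if Nat.eqb k j then 1 else 0)) (seq 0 n)).
  - rewrite <- sumf_plus. apply sumf_le; intros k Hk. apply in_seq in Hk.
    assert (0 <= A i k) by (apply HA; auto; lia).
    unfold indicator, add. destruct (y k), (Nat.eqb k j); simpl; lra.
  - rewrite (sumf_support _ [j]).
    + unfold sumf; simpl. rewrite Nat.eqb_refl; ring.
    + repeat constructor; simpl; tauto.
    + apply seq_NoDup.
    + intros k [<-|[]]; apply in_seq; lia.
    + intros k _ Hk. destruct (Nat.eqb_spec k j); [subst; simpl in Hk; tauto|ring].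
Qed.

(** Rejections only lower the load, so the tentative load, which the moment bound controls,
    dominates the accepted one. *)
Lemma rowdot_accepted i t : (i < m)%nat -> incl t (seq 0 n) ->
  rowdot n A i (indicator (acc t)) <= sumf (A i) t.
Proof.
  intros Hi; induction t as [|j t IH]; intros Ht.
  - unfold acc; simpl. rewrite rowdot_set0. apply Rle_refl.
  - assert (Hj : (j < n)%nat) by (specialize (Ht j (or_introl eq_refl)); apply in_seq in Ht; lia).
    assert (IH' := IH (fun x Hx => Ht x (or_intror Hx))).
    rewrite sumf_cons. pose proof (HA i j Hi Hj).
    unfold acc in *; simpl.
    destruct (int_feasibleb n m A b (add (accepted n m A b t) j)); [|lra].
    pose proof (rowdot_add i (accepted n m A b t) j Hi Hj). lra.
Qed.

(** [s] is the parameter of the exponential moment and [B] a lower bound on the normalised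
    capacities; [Hd] brings the union bound over the rows of an item to at most 1/2. *)
Variables (s B : R).
Hypothesis HB2 : 2 <= B.
Hypothesis HB : forall i, (i < m)%nat -> B <= b i / rowmax n A i.
Hypothesis Hs : 1 <= s.
Hypothesis Hd : 2 * INR (colsp n m A) * exp (- ((s - 1) * (B - 1))) <= 1.

Definition nzrows (j : nat) : list nat :=
  filter (fun i => if Req_EM_T (A i j) 0 then false else true) (seq 0 m).

Lemma nzrows_length j : (j < n)%nat -> (length (nzrows j) <= colsp n m A)%nat.
Proof.
  intros Hj. unfold colsp.
  assert (H : In j (seq 0 n)) by (apply in_seq; lia). clear Hj.
  induction (seq 0 n) as [|a L IH]; [contradiction|]. simpl fold_right.
  destruct H as [->|H]; [apply Nat.le_max_l|].
  eapply Nat.le_trans; [apply IH; auto|apply Nat.le_max_r].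
Qed.

(** A blocked item overflows a row in which its entry is nonzero. That entry is at most the row
    maximum, so the normalised tentative load exceeds the normalised capacity minus 1, and the term
    of this row is at least 1. *)
Lemma blocked_le j t : (j < n)%nat -> incl t (seq 0 n) ->
  blocked j t <= sumf (fun i => exp (- (s * (b i / rowmax n A i - 1))) * exp (s * wt i t)) (nzrows j).
Proof.
  intros Hj Ht.
  assert (Hpos : forall i, In i (nzrows j) ->
    0 <= exp (- (s * (b i / rowmax n A i - 1))) * exp (s * wt i t)).
  { intros i _. left; apply Rmult_lt_0_compat; apply exp_pos. }
  unfold blocked. destruct (int_feasibleb n m A b (add (acc t) j)) eqn:E.
  - now apply sumf_ge0.
  - assert (Hex : exists i, (i < m)%nat /\ b i < rowdot n A i (indicator (add (acc t) j))).
    { unfold int_feasibleb in E. clear Hpos.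
      assert (G : forall L, forallb (fun i => if Rle_dec (rowdot n A i (indicator (add (acc t) j))) (b i)
                        then true else false) L = false ->
          exists i, In i L /\ b i < rowdot n A i (indicator (add (acc t) j))).
      { induction L as [|i L IH]; simpl; [discriminate|]. intros HE.
        destruct (Rle_dec _ _) in HE.
        - destruct (IH HE) as (i' & Hi' & Hlt); exists i'; auto.
        - exists i; split; auto; lra. }
      destruct (G _ E) as (i & Hi & Hlt). exists i; split; auto. apply in_seq in Hi; lia. }
    destruct Hex as (i & Hi & Hlt).
    pose proof (rowdot_add i (acc t) j Hi Hj) as H1.
    pose proof (rowdot_accepted i t Hi Ht) as H2.
    pose proof (accepted_feasible t i Hi) as H3.
    pose proof (rowmax_ge i j Hj) as H4.
    assert (Hin : In i (nzrows j)).
    { unfold nzrows. apply filter_In; split; [apply in_seq; lia|].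
      destruct (Req_EM_T (A i j) 0); auto. lra. }
    eapply Rle_trans; [|apply (sumf_term_le _ _ i Hpos Hin)].
    rewrite <- exp_plus.
    assert (Hr := Hrow i Hi). set (r := rowmax n A i) in *.
    assert (Hw : sumf (A i) t = r * wt i t).
    { unfold wt. fold r. rewrite <- sumf_scal. apply sumf_ext; intros; field; lra. }
    assert (Hbr : b i = r * (b i / r)) by (field; lra).
    assert (0 <= wt i t - (b i / r - 1)).
    { apply Rmult_le_reg_l with r; auto. rewrite Rmult_0_r.
      replace (r * (wt i t - (b i / r - 1))) with (r * wt i t - (r * (b i / r) - r)) by ring.
      rewrite <- Hbr, <- Hw. lra. }
    pose proof (exp_ineq1_le (- (s * (b i / r - 1)) + s * wt i t)). nra.
Qed.

(** The threshold keeps the moment exponent of a row at most half its normalised capacity. *)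
Definition early (k : nat) : Prop := INR k / INR n <= exp (- s) / 2.

Lemma Ex_blocked k l j : arrived n k l -> early k -> (j < n)%nat ->
  Ex O k l (blocked j) <= 1 / 2.
Proof.
  intros Hl Hk Hj.
  eapply Rle_trans; [apply Ex_le; [auto|intros t Ht; apply blocked_le; auto]|].
  rewrite (Ex_sumf O k l (fun i t => exp (- (s * (b i / rowmax n A i - 1))) * exp (s * wt i t))).
  set (q := exp (- ((s - 1) * (B - 1)))) in *.
  assert (Hq : 0 < q) by apply exp_pos.
  apply Rle_trans with (sumf (fun _ => q) (nzrows j)).
  - apply sumf_le; intros i Hi. unfold nzrows in Hi. apply filter_In in Hi as [Hi _].
    apply in_seq in Hi. assert (Hi' : (i < m)%nat) by lia.
    rewrite Ex_scal.
    pose proof (Ex_exp_wt i s Hi' ltac:(lra) k l Hl) as HE.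
    pose proof (HB i Hi') as HBi.
    set (be := b i / rowmax n A i) in *.
    eapply Rle_trans; [apply Rmult_le_compat_l; [left; apply exp_pos|exact HE]|].
    rewrite <- exp_plus. unfold q.
    assert (HX : (exp s - 1) * be * (INR k / INR n) <= be / 2).
    { unfold early in Hk.
      pose proof (exp_ineq1_le s).
      assert (exp s * exp (- s) = 1) by (rewrite <- exp_plus, Rplus_opp_r; apply exp_0).
      assert (0 < exp (- s)) by apply exp_pos.
      apply Rle_trans with ((exp s - 1) * be * (exp (- s) / 2)).
      - apply Rmult_le_compat_l; auto. apply Rmult_le_pos; lra.
      - replace ((exp s - 1) * be * (exp (- s) / 2)) with (be / 2 * (exp s * exp (-s)) - be / 2 * exp (- s)) by field.
        nra. }
    (* Since [be] is at least [B] and hence 2, be / 2 is at most be - 1, which turns the coefficient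
       [s] into [s - 1]. *)
    assert (HY : - (s * (be - 1)) + (exp s - 1) * be * (INR k / INR n) <= - ((s - 1) * (B - 1))) by nra.
    destruct HY as [HY|HY]; [left; now apply exp_increasing|rewrite HY; apply Rle_refl].
  - rewrite sumf_const.
    assert (INR (length (nzrows j)) <= INR (colsp n m A)) by (apply le_INR, nzrows_length; auto).
    nra.
Qed.

(* A blocked item loses its marginal gain over the accepted items, which is at most its gain
   over the later picks [W] alone; given [W] and the item, it is blocked with probability at
   most 1/2. *)
Lemma accepted_vs_tentative k : forall l W, arrived n k l -> early k ->
  1 / 2 * h W + 1 / 2 * Ex O k l (fun t => h (setu (mem t) W))
  <= Ex O k l (fun t => h (setu (acc t) W)).
Proof.
  assert (Hm : mono h) by now apply setfun_mono.
  assert (Hdr : dimret h) by now apply setfun_dimret.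
  induction k as [|k IH]; intros l W Hl Hk.
  - change (1 / 2 * h W + 1 / 2 * h W <= h W). lra.
  - assert (Hk' : early k).
    { unfold early in *. eapply Rle_trans; [|exact Hk].
      assert (INR k <= INR (S k)) by (apply le_INR; lia).
      unfold Rdiv. apply Rmult_le_compat_r; auto.
      (* For [n] equal to 0, the inverse of zero is 0 by convention. *)
      destruct n; [unfold INR; rewrite Rinv_0; lra|].
      left; apply Rinv_0_lt_compat, lt_0_INR; lia. }
    set (p := fun j => O (S k) (mem l) j).
    set (Z := fun j => Ex O k (del j l) (fun t => h (setu (mem t) (add W j)))).
    set (Z0 := fun j => Ex O k (del j l) (fun t => h (setu (mem t) W))).
    (* When [j] is picked, the induction hypothesis at [add W j] yields half of [h (add W j)];
       giving up half of the marginal gain over [W] to blocking leaves half of [h W]. *)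
    apply Ex_ge with (B := fun j =>
      p j * (1 / 2 * h W + 1 / 2 * Z j) + (1 - p j) * (1 / 2 * h W + 1 / 2 * Z0 j)); auto.
    + rewrite (sumf_ext _ (fun j => 1 / 2 * h W + 1 / 2 * (p j * Z j + (1 - p j) * Z0 j)))
        by (intros; ring).
      rewrite sumf_plus, sumf_const, sumf_scal.
      assert (E : Ex O (S k) l (fun t => h (setu (mem t) W))
                  = / INR (S k) * sumf (fun j => p j * Z j + (1 - p j) * Z0 j) l).
      { rewrite ?Ex_S. f_equal. apply sumf_ext; intros j Hj. f_equal. f_equal.
        unfold Z. f_equal. apply functional_extensionality; intros t.
        now rewrite mem_cons, setu_add_l, setu_add_r. }
      rewrite E. destruct Hl as (_ & -> & _).
      assert (INR (S k) <> 0) by (apply not_0_INR; lia).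
      apply Req_le. field. auto.
    + intros j Hj. fold (p j).
      assert (Hj' := arrived_lt _ _ _ Hl Hj).
      assert (Ht := arrived_del _ _ _ _ Hl Hj).
      destruct (oracle01 (S k) l j Hj') as [Hp0 Hp1]. fold (p j) in Hp0, Hp1.
      pose proof (IH _ W Ht Hk') as I0. pose proof (IH _ (add W j) Ht Hk') as I1.
      fold (Z j) in I1. fold (Z0 j) in I0.
      apply Rplus_le_compat; [|apply Rmult_le_compat_l; [lra|exact I0]].
      apply Rmult_le_compat_l; [lra|].
      apply Rle_trans with (Ex O k (del j l)
        (fun t => h (setu (acc t) (add W j)) + - (h (add W j) - h W) * blocked j t)).
      * rewrite Ex_lin.
        pose proof (Ex_blocked k (del j l) j Ht Hk' Hj').
        pose proof (Hm _ _ (incls_add W j)). nra.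
      * apply Ex_le; auto. intros t _. unfold blocked, acc; simpl.
        rewrite setu_add_r.
        destruct (int_feasibleb n m A b (add (accepted n m A b t) j)).
        -- rewrite setu_add_l; lra.
        (* If [j] is blocked, its gain over [W] and the accepted items is at most the gain over [W]
           that was subtracted. *)
        -- pose proof (Hdr W (setu (accepted n m A b t) W) j (setu_incls_r _ _)). lra.
Qed.

(** * Value of the tentative picks and of the whole run *)

Variable x : nat -> R.
Hypothesis Hx : feasible_frac n m A b x.
(** The benchmark for the rounds played on [l]: the multilinear value of [x] restricted to these
    items. *)
Let phi (l : list nat) : R := EB (seq 0 n) (restr x l) h set0.

Lemma in01_restr l : in01 (restr x l) (seq 0 n).
Proof.
  intros j Hj. apply in_seq in Hj. unfold restr. destruct Hx as [H _].
  destruct (mem l j); [apply H; lia|lra].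
Qed.

Lemma phi_ge0 l : 0 <= phi l.
Proof.
  unfold phi. rewrite <- (Rmult_0_l (EB (seq 0 n) (restr x l) h set0)), <- EB_scal.
  apply EB_le; [apply in01_restr|]. intros Z; rewrite Rmult_0_l; apply setfun_ge0.
Qed.

Lemma phi_del k l : arrived n (S k) l ->
  INR k * phi l <= sumf (fun j => phi (del j l)) l.
Proof.
  intros (H1 & H2 & H3). apply EB_restr_del; auto.
  - now apply setfun_dimret.
  - apply setfun_ge0.
  - intros j Hj; apply in_seq in Hj. apply Hx; lia.
Qed.

(* [(k/n) x] restricted to [l] is feasible for the oracle in round [k]. *)
Lemma oracle_value k l : (k <= n)%nat -> arrived n k l ->
  alpha * (INR k / INR n) * phi l <= multilin n f (O k (mem l)).
Proof.
  intros Hkn Hl. destruct (HO k (mem l)) as [_ Hopt].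
  assert (Hlam : 0 <= INR k / INR n <= 1).
  { destruct (Nat.eq_dec n 0) as [E|E].
    - assert (k = 0)%nat by lia. subst k. rewrite E. simpl. unfold Rdiv; rewrite Rmult_0_l; lra.
    - assert (0 < INR n) by (apply lt_0_INR; lia). split.
      + apply Rle_mult_inv_pos; auto using pos_INR.
      + apply Rmult_le_reg_r with (INR n); auto. unfold Rdiv.
        rewrite Rmult_assoc, Rinv_l, Rmult_1_r, Rmult_1_l by lra. now apply le_INR. }
  set (lam := INR k / INR n) in *.
  assert (HP : inP n m A b k (mem l) (fun i => lam * restr x l i)).
  { split; [|split].
    - intros j Hj. pose proof (in01_restr l j (proj2 (in_seq _ _ _) (conj (Nat.le_0_l _) Hj))). nra.
    - intros i Hi. fold lam. apply Rle_trans with (lam * rowdot n A i x);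
        [|apply Rmult_le_compat_l; [lra|apply Hx; auto]].
      unfold rowdot, sum_lt.
      change (sumf (fun j => A i j * (lam * restr x l j)) (seq 0 n)
              <= lam * sumf (fun j => A i j * x j) (seq 0 n)).
      rewrite <- sumf_scal. apply sumf_le; intros j Hj. apply in_seq in Hj.
      assert (0 <= A i j) by (apply HA; auto; lia).
      assert (restr x l j <= x j)
        by (unfold restr; destruct (mem l j); [lra|apply Hx; lia]).
      rewrite <- Rmult_assoc, (Rmult_comm (A i j)), Rmult_assoc.
      apply Rmult_le_compat_l; [lra|]. now apply Rmult_le_compat_l.
    - intros j _ E. unfold restr. rewrite E. ring. }
  specialize (Hopt _ HP). eapply Rle_trans; [|exact Hopt].
  rewrite Rmult_assoc. apply Rmult_le_compat_l; [lra|].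
  rewrite multilin_EB. fold h.
  pose proof (EB_scale_ge (seq 0 n) (restr x l) h lam set0
    (setfun_dimret n f Hfm Hfs) (in01_restr l) Hlam) as HE.
  pose proof (setfun_ge0 set0). fold (phi l) in HE. nra.
Qed.

(* [W] collects the tentative picks of later rounds, on which the expected gain of a round is
   conditioned.  Only the gains of the rounds after [l0] are counted, so that the loss
   [h W / k] of each round multiplies up to no more than [l0 / k]. *)
Lemma tentative_value l0 k : (1 <= l0 <= k)%nat -> (k <= n)%nat -> forall l W, arrived n k l ->
  (INR k - INR l0) * INR l0 * alpha / (INR n * INR k) * phi l + INR l0 / INR k * h W
  <= Ex O k l (fun t => h (setu (mem t) W)).
Proof.
  assert (Hm : mono h) by now apply setfun_mono.
  intros [H0 Hk]. induction Hk as [|k Hk IH]; intros Hkn l W Hl.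
  (* At [k = l0] the coefficient of [phi] vanishes and that of [h W] is 1, so monotonicity
     suffices. *)
  - apply Rle_trans with (h W).
    + assert (0 < INR l0) by (apply lt_0_INR; lia).
      rewrite Rminus_diag. unfold Rdiv. rewrite !Rmult_0_l, Rinv_r by lra. lra.
    + rewrite <- (Rmult_1_l (h W)).
      replace (1 * h W) with (Ex O l0 l (fun _ => 1 * h W)).
      * apply Ex_le; auto. intros t _. rewrite Rmult_1_l. apply Hm, setu_incls_r.
      * rewrite (Ex_scal O l0 l 1 (fun _ => h W)). f_equal.
        assert (G : forall k l, length l = k -> NoDup l -> Ex O k l (fun _ => h W) = h W).
        { induction k as [|k IHk]; intros L HL HN; [reflexivity|]. rewrite ?Ex_S.
          rewrite (sumf_ext _ (fun _ => h W)).
          - rewrite sumf_const, HL. field. apply not_0_INR; lia.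
          - intros j Hj. rewrite IHk by auto using del_length, del_nodup. ring. }
        apply G; apply Hl.
  - specialize (IH ltac:(lia)).
    assert (HkR : 0 < INR k) by (apply lt_0_INR; lia).
    assert (HnR : 0 < INR n) by (apply lt_0_INR; lia).
    assert (Hl0 : 0 < INR l0) by (apply lt_0_INR; lia).
    assert (Hkl : INR l0 <= INR k) by (apply le_INR; lia).
    set (u := (INR k - INR l0) * INR l0 * alpha / (INR n * INR k)) in *.
    set (v := INR l0 / INR k) in *.
    assert (Hv : 0 <= v) by (apply Rle_mult_inv_pos; lra).
    assert (Hu : 0 <= u).
    { apply Rle_mult_inv_pos; [|nra]. apply Rmult_le_pos; [|lra]. apply Rmult_le_pos; lra. }
    apply Ex_ge with (B := fun j =>
      u * phi (del j l) + (v * h W + v * (O (S k) (mem l) j * (h (add W j) - h W)))); auto.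
    + rewrite !sumf_plus, sumf_const, !sumf_scal.
      assert (Hlen := proj1 (proj2 Hl)). rewrite Hlen.
      pose proof (phi_del k l Hl) as HP.
      pose proof (oracle_value (S k) l Hkn Hl) as HV.
      pose proof (EB_le_marginals (seq 0 n) (O (S k) (mem l)) h W set0 Hm
        (setfun_dimret n f Hfm Hfs)) as HM.
      rewrite setu_set0_r, oracle_sum in HM by auto.
      rewrite multilin_EB in HV. fold h in HV.
      assert (HM' := HM ltac:(intros j Hj; apply in_seq in Hj; apply oracle01; lia)). clear HM.
      set (Sg := sumf (fun j => O (S k) (mem l) j * (h (add W j) - h W)) l) in *.
      (* The expected marginal gains over [W] sum to at least the oracle's value minus [h W]. *)
      assert (HG : alpha * (INR (S k) / INR n) * phi l - h W <= Sg) by lra.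
      apply Rle_trans with (u * (INR k * phi l) + (INR (S k) * (v * h W)
        + v * (alpha * (INR (S k) / INR n) * phi l - h W))).
      2:{ apply Rplus_le_compat; [now apply Rmult_le_compat_l|].
          apply Rplus_le_compat_l. now apply Rmult_le_compat_l. }
      (* The coefficients of [h W] match exactly; that of [phi l] leaves the slack l0 alpha / (n
         k). *)
      apply Rminus_le. unfold u, v. rewrite S_INR.
      match goal with |- ?a <= 0 =>
        replace a with (- (INR l0 * alpha * phi l / (INR n * INR k))) by (field; lra) end.
      pose proof (phi_ge0 l).
      assert (0 <= INR l0 * alpha * phi l / (INR n * INR k)); [|lra].
      apply Rle_mult_inv_pos; [|nra]. apply Rmult_le_pos; auto. apply Rmult_le_pos; lra.
    + intros j Hj.
      assert (Hj' := arrived_lt _ _ _ Hl Hj).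
      assert (Ht := arrived_del _ _ _ _ Hl Hj).
      destruct (oracle01 (S k) l j Hj') as [Hp0 Hp1].
      set (p := O (S k) (mem l) j) in *.
      pose proof (IH _ W Ht) as I0. pose proof (IH _ (add W j) Ht) as I1.
      replace (fun t => h (setu (mem (j :: t)) W)) with (fun t => h (setu (mem t) (add W j)))
        by (apply functional_extensionality; intros t;
            now rewrite mem_cons, setu_add_l, setu_add_r).
      apply (Rmult_le_compat_l p) in I1; [|lra].
      apply (Rmult_le_compat_l (1 - p)) in I0; [|lra]. lra.
Qed.

(** Rounds after [L] never shrink the accepted set, so only [phi] is averaged: each of them costs a
    factor k/(k+1), and these telescope. *)
Lemma late_rounds L c : (1 <= L)%nat -> 0 <= c ->
  (forall l, arrived n L l -> c * phi l <= Ex O L l (fun t => h (acc t))) ->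
  forall k, (L <= k)%nat -> forall l, arrived n k l ->
  c * (INR L / INR k) * phi l <= Ex O k l (fun t => h (acc t)).
Proof.
  intros HL Hc Hbase k Hk.
  assert (Hm : mono h) by now apply setfun_mono.
  induction Hk as [|k Hk IH]; intros l Hl.
  - assert (0 < INR L) by (apply lt_0_INR; lia).
    replace (INR L / INR L) with 1 by (field; lra). rewrite Rmult_1_r. auto.
  - assert (HkR : 0 < INR k) by (apply lt_0_INR; lia).
    assert (HSR : 0 < INR (S k)) by (apply lt_0_INR; lia).
    apply Ex_ge with (B := fun j => c * (INR L / INR k) * phi (del j l)); auto.
    + rewrite sumf_scal. pose proof (phi_del k l Hl).
      apply Rle_trans with (c * (INR L / INR k) * (INR k * phi l)).
      * apply Req_le; field; lra.
      * apply Rmult_le_compat_l; auto. apply Rmult_le_pos; auto.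
        apply Rle_mult_inv_pos; auto using pos_INR.
    + intros j Hj.
      assert (Hj' := arrived_lt _ _ _ Hl Hj).
      assert (Ht := arrived_del _ _ _ _ Hl Hj).
      destruct (oracle01 (S k) l j Hj') as [Hp0 Hp1].
      pose proof (IH _ Ht) as I0.
      assert (I1 : Ex O k (del j l) (fun t => h (acc t))
                   <= Ex O k (del j l) (fun t => h (acc (j :: t)))).
      { apply Ex_le; auto. intros t _. apply Hm. unfold acc; simpl.
        destruct (int_feasibleb n m A b (add (accepted n m A b t) j)); [apply incls_add|].
        intros i Hi; auto. }
      set (p := O (S k) (mem l) j) in *. nra.
Qed.

Lemma expected_value_ge l0 : (1 <= l0)%nat -> (2 * l0 <= n)%nat -> early (2 * l0) ->
  alpha * (INR l0 / INR n) ^ 2 / 2 * multilin n f x <= expected_value n m A b f O.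
Proof.
  intros H1 H2 He. rewrite expected_value_Ex.
  assert (HnR : 0 < INR n) by (apply lt_0_INR; lia).
  assert (HlR : 0 < INR l0) by (apply lt_0_INR; lia).
  assert (EL : INR (2 * l0) = 2 * INR l0) by (rewrite mult_INR; simpl; ring).
  (* For round [2 * l0], [tentative_value] yields the coefficient [2 * c], half of which survives
     blocking; the later rounds contribute the factor 2 l0 / n. *)
  set (c := INR l0 * alpha / (4 * INR n)).
  assert (Hbase : forall l, arrived n (2 * l0) l ->
            c * phi l <= Ex O (2 * l0) l (fun t => h (acc t))).
  { intros l Hl.
    pose proof (tentative_value l0 (2 * l0) ltac:(lia) H2 l set0 Hl) as HT.
    pose proof (accepted_vs_tentative (2 * l0) l set0 Hl He) as HC.
    rewrite EL in HT. pose proof (setfun_ge0 set0).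
    assert (E : (2 * INR l0 - INR l0) * INR l0 * alpha / (INR n * (2 * INR l0)) = 2 * c)
      by (unfold c; field; lra).
    rewrite E in HT.
    replace (INR l0 / (2 * INR l0)) with (1 / 2) in HT by (field; lra).
    replace (fun t => h (acc t)) with (fun t => h (setu (acc t) set0))
      by (apply functional_extensionality; intros; now rewrite setu_set0_r).
    lra. }
  assert (Hc : 0 <= c) by (apply Rle_mult_inv_pos; [|lra]; apply Rmult_le_pos; lra).
  pose proof (late_rounds (2 * l0) c ltac:(lia) Hc Hbase n H2 (seq 0 n)) as HH.
  assert (Hall : arrived n n (seq 0 n))
    by (repeat split; [apply seq_NoDup|apply length_seq|intros i Hi; auto]).
  specialize (HH Hall).
  (* Restricting to all of U changes nothing, since every sampled set lies in U. *)
  assert (Ephi : phi (seq 0 n) = multilin n f x).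
  { rewrite multilin_EB. unfold phi. fold h.
    change set0 with (inter set0 (seq 0 n)) at 1. rewrite EB_restr.
    assert (G : forall is Y, incl is (seq 0 n) -> (forall i, Y i = true -> In i (seq 0 n)) ->
       EB is x (fun Z => h (inter Z (seq 0 n))) Y = EB is x h Y).
    { induction is as [|i is IH]; intros Y Hi HY; simpl.
      - f_equal. apply functional_extensionality; intros i. unfold inter.
        destruct (Y i) eqn:E; auto. simpl. apply mem_spec, HY, E.
      - rewrite !IH; auto; try (intros k Hk; apply Hi; now right).
        intros k; unfold add; intros E; apply Bool.orb_true_iff in E as [E|E]; auto.
        apply Nat.eqb_eq in E as ->. apply Hi; now left. }
    apply G; [intros i Hi; auto|discriminate]. }
  rewrite Ephi in HH. unfold h, acc in HH.
  eapply Rle_trans; [|exact HH]. apply Req_le. rewrite EL. unfold c. field; lra.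
Qed.

End Analysis.

(** * Choice of the threshold and conclusion *)

Lemma capB_le n m A b i : (i < m)%nat -> capB n m A b <= b i / rowmax n A i.
Proof.
  intros Hi. unfold capB. assert (H : In i (seq 0 m)) by (apply in_seq; lia).
  destruct (seq 0 m) as [|i0 L]; [contradiction|].
  induction L as [|a L IH]; simpl.
  - destruct H as [->|[]]; apply Rle_refl.
  - destruct H as [->|[->|H]].
    + eapply Rle_trans; [apply Rmin_r|apply IH; now left].
    + apply Rmin_l.
    + eapply Rle_trans; [apply Rmin_r|apply IH; now right].
Qed.

Lemma nat_floor r : 0 <= r -> exists k, INR k <= r < INR k + 1.
Proof.
  intros Hr. destruct (INR_unbounded r) as [N HN].
  induction N as [|N IH]; [simpl in HN; lra|].
  destruct (Rlt_le_dec r (INR N)); [apply IH; lra|].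
  exists N. rewrite S_INR in HN. lra.
Qed.

(* The analysis counts the first [p n] rounds, where [p = exp (-s) / 2] and
   [s = 1 + ln (2 d) / (B - 1)] makes the union bound over [d] rows equal to 1/2. *)
Lemma threshold_sq d B : 1 <= d -> 2 <= B ->
  exp (-2) / 16 * Rpower d (- (2 / (B - 1))) <= (exp (- (1 + ln (2 * d) / (B - 1))) / 2) ^ 2.
Proof.
  intros Hd HB. unfold Rpower. rewrite ln_mult by lra.
  set (q := / (B - 1)). assert (Hq : 0 < q <= 1).
  { unfold q; split; [apply Rinv_0_lt_compat; lra|].
    rewrite <- Rinv_1. apply Rinv_le_contravar; lra. }
  replace ((exp (- (1 + (ln 2 + ln d) / (B - 1))) / 2) ^ 2)
    with (exp (-2) / 4 * (exp (- (2 / (B - 1)) * ln d) * exp (- (2 * q * ln 2)))).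
  - assert (H2 : / 4 <= exp (- (2 * q * ln 2))).
    { replace (/ 4) with (exp (- (2 * ln 2))).
      - assert (0 < ln 2) by (rewrite <- ln_1; apply ln_increasing; lra).
        assert (HH : - (2 * ln 2) <= - (2 * q * ln 2)) by nra.
        destruct HH as [HH|HH]; [left; now apply exp_increasing|rewrite HH; apply Rle_refl].
      - rewrite exp_Ropp. replace (2 * ln 2) with (ln 2 + ln 2) by ring.
        rewrite exp_plus, exp_ln by lra. f_equal; ring. }
    set (E := exp (- (2 / (B - 1)) * ln d)). assert (0 < E) by apply exp_pos.
    assert (0 < exp (-2)) by apply exp_pos.
    assert (0 < exp (-2) * E) by nra. nra.
  - transitivity (exp (- (1 + (ln 2 + ln d) / (B - 1))) * exp (- (1 + (ln 2 + ln d) / (B - 1))) / 4);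
      [|field].
    rewrite <- !exp_plus. unfold Rdiv at 1. rewrite (Rmult_comm (exp (-2))), Rmult_assoc.
    rewrite <- exp_plus. unfold Rdiv. rewrite (Rmult_comm (/ 4)). f_equal. f_equal.
    fold q. ring.
Qed.

Theorem mainTheorem14 :
  exists c0 : R, 0 < c0 /\
  exists g : nat -> R, Un_cv g 0 /\
  forall (n m : nat) (A : nat -> nat -> R) (b : nat -> R) (f : list bool -> R)
         (alpha : R) (O : nat -> (nat -> bool) -> nat -> R) (Fstar : R),
    (1 <= m)%nat ->
    (forall i j, (i < m)%nat -> (j < n)%nat -> 0 <= A i j <= 1) ->
    (forall i, (i < m)%nat -> exists j, (j < n)%nat /\ 0 < A i j) ->
    (forall i, (i < m)%nat -> 0 < b i) ->
    nonneg_setfun n f -> monotone_setfun n f -> submodular_setfun n f ->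
    0 < alpha <= 1 ->
    oracle_ok n m A b f alpha O ->
    is_Fstar n m A b f Fstar ->
    2 <= capB n m A b ->
    (forall sigma cs, In sigma (perms (seq 0 n)) -> length cs = n ->
        int_feasible n m A b (fst (run n m A b O sigma cs))) /\
    (c0 * alpha * Rpower (INR (colsp n m A)) (- (2 / (capB n m A b - 1))) - g n) * Fstar
      <= expected_value n m A b f O.
Proof.
  (* 512 is 16 from [threshold_sq], times 16 from l0 / n being at least p / 4, times 2 from
     [expected_value_ge]. *)
  exists (exp (-2) / 512). split; [pose proof (exp_pos (-2)); lra|].
  (* The error term covers the inputs with p n < 2, where [l0] below is 0. *)
  exists (fun n => / (INR n + 1)). split; [exact RinvN_cv|].
  intros n m A b f alpha O Fs Hm HA Hne Hb Hf0 Hfm Hfs Ha HO HF HB.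
  assert (HA0 : forall i j, (i < m)%nat -> (j < n)%nat -> 0 <= A i j)
    by (intros; now apply HA).
  assert (Hrow : forall i, (i < m)%nat -> 0 < rowmax n A i).
  { intros i Hi. destruct (Hne i Hi) as (j & Hj & Hpos).
    pose proof (rowmax_ge n A i j Hj); lra. }
  split; [intros; now apply run_feasible, set0_feasible|].
  set (B := capB n m A b) in *. set (d := INR (colsp n m A)).
  destruct (Hne 0%nat ltac:(lia)) as (j0 & Hj0 & Hpos0).
  assert (Hn : 1 <= INR n) by (apply (le_INR 1); lia).
  assert (Hd1 : 1 <= d).
  { apply (le_INR 1). eapply Nat.le_trans; [|apply (nzrows_length n m A j0 Hj0)].
    destruct (nzrows m A j0) as [|i L] eqn:E; [|simpl; lia]. exfalso.
    assert (H : In 0%nat (nzrows m A j0)).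
    { apply filter_In; split; [apply in_seq; lia|]. destruct (Req_EM_T _ _); auto; lra. }
    rewrite E in H; contradiction. }
  set (s := 1 + ln (2 * d) / (B - 1)).
  assert (Hln : 0 <= ln (2 * d)).
  { rewrite <- ln_1. destruct (Rle_lt_or_eq_dec 1 (2 * d)); [lra| |lra].
    left; apply ln_increasing; lra. }
  assert (Hs : 1 <= s).
  { unfold s. assert (0 <= ln (2 * d) / (B - 1)) by (apply Rle_mult_inv_pos; lra). lra. }
  assert (Hde : 2 * d * exp (- ((s - 1) * (B - 1))) <= 1).
  { replace ((s - 1) * (B - 1)) with (ln (2 * d)) by (unfold s; field; lra).
    rewrite exp_Ropp, exp_ln by lra. rewrite Rinv_r by lra. lra. }
  pose proof (threshold_sq d B Hd1 HB) as HK. fold s in HK.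
  set (K := Rpower d (- (2 / (B - 1)))) in *. assert (HK0 : 0 < K) by apply exp_pos.
  set (p := exp (- s) / 2) in *.
  assert (Hp : 0 < p < 1).
  { unfold p. pose proof (exp_pos (- s)).
    assert (exp (- s) < 1) by (rewrite <- exp_0; apply exp_increasing; lra). lra. }
  destruct HF as [Hub Hlub].
  assert (HFs : 0 <= Fs).
  { apply Rle_trans with (multilin n f (indicator set0)).
    - rewrite multilin_EB.
      rewrite <- (Rmult_0_l (EB (seq 0 n) (indicator set0) (setfun n f) set0)), <- EB_scal.
      apply EB_le; [intros i _; unfold indicator, set0; lra|].
      intros Z; rewrite Rmult_0_l; now apply setfun_ge0.
    - apply Hub. exists (indicator set0); split; auto. split.
      + intros; unfold indicator, set0; lra.
      + intros i Hi. rewrite rowdot_set0. left; auto. }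
  pose proof (exp_pos (-2)) as He2.
  assert (Hg : 0 < / (INR n + 1)) by (apply Rinv_0_lt_compat; lra).
  (* With this [l0] the round [2 * l0] is still early, as 2 l0 is at most p n. *)
  destruct (nat_floor (p * INR n / 2)) as (l0 & Hl1 & Hl2); [nra|].
  destruct (Nat.eq_dec l0 0) as [->|Hl0].
  (* As p n < 2, the competitive factor is at most p^2 / 8, hence at most the error term, and the
     left side is nonpositive. *)
  - apply Rle_trans with 0.
    + assert (Hpn : p * INR n < 2) by (simpl in Hl2; lra).
      assert (Hsq : p ^ 2 * INR n * INR n <= 4).
      { assert (0 < p * INR n) by nra.
        replace (p ^ 2 * INR n * INR n) with ((p * INR n) * (p * INR n)) by ring. nra. }
      assert (Hp2 : p ^ 2 / 8 <= / (INR n + 1)).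
      { apply Rmult_le_reg_r with (INR n + 1); [lra|]. rewrite Rinv_l by lra.
        assert (0 < p ^ 2) by (simpl; nra).
        assert (p ^ 2 * INR n <= p ^ 2 * INR n * INR n) by nra. nra. }
      assert (exp (-2) / 512 * alpha * K <= p ^ 2 / 8).
      { assert (0 < exp (-2) * K) by nra. nra. }
      nra.
    + rewrite expected_value_Ex. rewrite <- (Ex_0 O n (seq 0 n)) at 1.
      eapply Ex_le; eauto.
      * repeat split; [apply seq_NoDup|apply length_seq|intros i Hi; auto].
      * intros t _; now apply setfun_ge0.
  - set (C := exp (-2) / 512 * alpha * K).
    assert (HC : 0 < C) by (unfold C; apply Rmult_lt_0_compat; [nra|lra]).
    assert (Hmain : C * Fs <= expected_value n m A b f O).
    { assert (HlR : 1 <= INR l0) by (apply (le_INR 1); lia).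
      assert (EL : INR (2 * l0) = 2 * INR l0) by (rewrite mult_INR; simpl; ring).
      assert (HE : forall x, feasible_frac n m A b x ->
                     C * multilin n f x <= expected_value n m A b f O).
      { intros x Hx.
        assert (Hx0 : 0 <= multilin n f x).
        { rewrite multilin_EB.
          rewrite <- (Rmult_0_l (EB (seq 0 n) x (setfun n f) set0)), <- EB_scal.
          apply EB_le; [intros i Hi; apply in_seq in Hi; apply Hx; lia|].
          intros Z; rewrite Rmult_0_l; now apply setfun_ge0. }
        eapply Rle_trans; [|apply (expected_value_ge n m A b f alpha O HA0 Hb Hrow Hf0 Hfm Hfs
          Ha HO s B HB (fun i Hi => capB_le n m A b i Hi) Hs Hde x Hx l0)].
        - apply Rmult_le_compat_r; auto.
          (* As [l0] is at least 1, p n / 2 < l0 + 1 <= 2 l0. *)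
          assert (Hr : p / 4 <= INR l0 / INR n).
          { apply Rmult_le_reg_r with (INR n); [lra|]. unfold Rdiv at 2.
            rewrite Rmult_assoc, Rinv_l by lra. lra. }
          assert (Hr2 : p ^ 2 / 16 <= (INR l0 / INR n) ^ 2).
          { set (r := INR l0 / INR n) in *. simpl. nra. }
          unfold C. set (r2 := (INR l0 / INR n) ^ 2) in *.
          replace (exp (-2) / 512 * alpha * K) with (alpha * (exp (-2) / 16 * K / 16) / 2) by field.
          assert (alpha * (exp (-2) / 16 * K / 16) <= alpha * r2)
            by (apply Rmult_le_compat_l; lra).
          lra.
        - lia.
        - apply INR_le. rewrite EL. nra.
        - unfold early. fold p. rewrite EL.
          apply Rmult_le_reg_r with (INR n); [lra|]. unfold Rdiv.
          rewrite Rmult_assoc, Rinv_l by lra. lra. }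
      (* [Fs] is only known as a supremum, so the bound for each feasible [x] is divided by [C] and
         passed to the least upper bound. *)
      assert (Fs <= expected_value n m A b f O / C).
      { apply Hlub. intros v (x & Hx & ->). apply Rmult_le_reg_l with C; auto.
        replace (C * (expected_value n m A b f O / C)) with (expected_value n m A b f O)
          by (field; lra). auto. }
      apply (Rmult_le_compat_l C) in H; [|lra].
      replace (C * (expected_value n m A b f O / C)) with (expected_value n m A b f O) in H
        by (field; lra). exact H. }
    fold C. nra.
Qed.
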